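(* Let $X_1,\dots,X_m$ be jointly Gaussian scalar random variables with covariance matrix $\mathbf{\Sigma}\succ\mathbf{0}$. Then the multivariate Wyner common information of $X_1,\dots,X_m$ is given by $$\frac12\inf_{\mathbf{\Lambda}}\log\frac{|\mathbf{\Sigma}|}{|\mathbf{\Lambda}|},$$ where the infimum is over all diagonal matrices $\mathbf{\Lambda}$ with positive diagonal entries satisfying $\mathbf{\Lambda}\preceq\mathbf{\Sigma}$.
   Context: The multivariate Wyner common information of $(X_1,\dots,X_m)$ is $\inf I(U;X_1,\dots,X_m)$, the infimum being over all auxiliary random variables $U$ (on an arbitrary alphabet, jointly distributed with $(X_1,\dots,X_m)$, whose joint law is kept fixed) such that $X_1,\dots,X_m$ are mutually conditionally independent given $U$. $I$ denotes mutual information (same logarithm base as in the formula), $|\cdot|$ the determinant, and $\preceq$ the positive semidefinite order. *)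

(* Defs.v *)
From HB Require Import structures.
From mathcomp Require Import all_boot all_order all_algebra.
From mathcomp Require Import all_classical all_reals all_analysis.

Set Implicit Arguments.
Unset Strict Implicit.
Unset Printing Implicit Defensive.

Import Order.TTheory GRing.Theory Num.Theory.
Import numFieldNormedType.Exports.

Local Open Scope classical_set_scope.
Local Open Scope ring_scope.

(* [ln] is extended by 0 outside the positive reals, hence so is [logb b]. *)
Definition logb (R : realType) (b x : R) : R := ln x / ln b.

Section matrices.
Context {R : realType} {n : nat}.
Implicit Types A B : 'M[R]_n.

Definition posdefmx A : Prop :=
  A^T = A /\ forall u : 'rV[R]_n, u != 0 -> 0 < (u *m A *m u^T) 0 0.

Definition possemidefmx A : Prop :=
  A^T = A /\ forall u : 'rV[R]_n, 0 <= (u *m A *m u^T) 0 0.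

Definition loewner_le A B : Prop := possemidefmx (B - A).

End matrices.

Section random_pair.
Context {d d1 d2 : measure_display} {Omega : measurableType d}
  {T1 : measurableType d1} {T2 : measurableType d2}.
Variables (X : {mfun Omega >-> T1}) (Y : {mfun Omega >-> T2}).

Definition rpair (w : Omega) : T1 * T2 := (X w, Y w).

Let measurable_rpair : measurable_fun [set: Omega] rpair.
Proof. exact/measurable_fun_pair. Qed.

HB.instance Definition _ := isMeasurableFun.Build _ _ _ _ rpair measurable_rpair.

End random_pair.

Section random_vector.
Context {d d' : measure_display} {Omega : measurableType d}
  {T : measurableType d'} {m : nat}.
Variable X : 'I_m -> {mfun Omega >-> T}.

Definition rvector (w : Omega) : m.-tuple T := [tuple X i w | i < m].

Let measurable_rvector : measurable_fun [set: Omega] rvector.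
Proof.
apply/measurable_fun_tnthP => i.
rewrite (_ : _ \o _ = X i); last by apply/funext => w /=; rewrite tnth_mktuple.
exact: measurable_funPT.
Qed.

HB.instance Definition _ :=
  isMeasurableFun.Build _ _ _ _ rvector measurable_rvector.

End random_vector.

Section information.
Local Open Scope ereal_scope.
Local Open Scope charge_scope.

(* D(mu || nu), in units of [log_b]. For 1 < b, the negative part of the
   integrand is mu-integrable, so that the integral is well defined. *)
Definition kl_divergence {R : realType} (b : R) {d : measure_display}
    {T : measurableType d} (mu nu : probability T R) : \bar R :=
  if `[< mu `<< nu >] then
    \int[mu]_x (logb b (fine (('d (charge_of_finite_measure mu) '/d nu) x)))%:E
  else +oo.

Definition mutual_information {R : realType} (b : R)
    {d d1 d2 : measure_display} {Omega : measurableType d}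
    {T1 : measurableType d1} {T2 : measurableType d2} (P : probability Omega R)
    (U : {RV P >-> T1}) (X : {RV P >-> T2}) : \bar R :=
  kl_divergence b (distribution P (rpair U X))
    (distribution P U \x distribution P X).

End information.

Section conditional_independence.
Local Open Scope ereal_scope.
Context {R : realType} {d d' : measure_display} {Omega : measurableType d}
  {T : measurableType d'} (P : probability Omega R) (U : {RV P >-> T}).

(* g is a version of u |-> P(E | U = u). *)
Definition is_cond_prob (E : set Omega) (g : T -> R) : Prop :=
  measurable_fun [set: T] g /\
  forall B, measurable B ->
    P (E `&` U @^-1` B) = \int[distribution P U]_(u in B) (g u)%:E.

(* For all Borel sets B_i,
   P(X_i \in B_i for all i | U) = \prod_i P(X_i \in B_i | U) almost surely;
   conditional probabilities exist and are unique almost surely, so that the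
   choice of the versions is immaterial. *)
Definition mutually_cond_independent {m : nat} (X : 'I_m -> {RV P >-> R}) :
    Prop :=
  forall B : 'I_m -> set R, (forall i, measurable (B i)) ->
  exists g : 'I_m -> T -> R,
    (forall i, is_cond_prob (X i @^-1` B i) (g i)) /\
    is_cond_prob [set w | forall i, B i (X i w)] (fun u => (\prod_i g i u)%R).

End conditional_independence.

(* The infimum ranges over all couplings (U, Y), on any probability space, of
   an auxiliary U with a copy Y of X, i.e. a vector with the joint law of X. *)
Definition wyner_common_information {R : realType} (b : R) {m : nat}
    {d : measure_display} {Omega : measurableType d} (P : probability Omega R)
    (X : 'I_m -> {RV P >-> R}) : \bar R :=
  ereal_inf [set I : \bar R |
    exists (d1 d2 : measure_display) (Omega1 : measurableType d1)
      (T : measurableType d2) (P1 : probability Omega1 R)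
      (Y : 'I_m -> {RV P1 >-> R}) (U : {RV P1 >-> T}),
    [/\ forall A : set (m.-tuple R), measurable A ->
          distribution P1 (rvector Y) A = distribution P (rvector X) A,
        mutually_cond_independent U Y &
        I = mutual_information b U (rvector Y)]].

Section lebesgue_tuple.
Context {R : realType}.

Section cons_measure.
Local Open Scope ereal_scope.
Context {n : nat}.
Variable nu : {sigma_finite_measure set (n.-tuple R) -> \bar R}.

Definition cons_tuple (p : measurableTypeR R * n.-tuple R) : n.+1.-tuple R :=
  [tuple of p.1 :: p.2].

Let measurable_cons_tuple :
  measurable_fun [set: measurableTypeR R * n.-tuple R] cons_tuple.
Proof. exact: (measurable_cons measurable_fst measurable_snd). Qed.

Definition cons_measure : set (n.+1.-tuple R) -> \bar R :=
  pushforward (@lebesgue_measure R \x nu) cons_tuple.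

Let cons_measure0 : cons_measure set0 = 0.
Proof. by rewrite /cons_measure /pushforward preimage_set0 measure0. Qed.

Let cons_measure_ge0 A : 0 <= cons_measure A.
Proof. exact: measure_ge0. Qed.

Let cons_measure_sigma_additive : semi_sigma_additive cons_measure.
Proof.
have mpre A : measurable A -> measurable (cons_tuple @^-1` A).
  by move=> mA; rewrite -[X in measurable X]setTI; exact: measurable_cons_tuple.
move=> F mF tF mUF; rewrite /cons_measure /pushforward preimage_bigcup.
apply: measure_semi_sigma_additive => [i||]; first exact: mpre.
- apply/trivIsetP => i j _ _ ij; rewrite -preimage_setI.
  by move/trivIsetP : tF => /(_ _ _ _ _ ij) ->//; rewrite preimage_set0.
- by rewrite -preimage_bigcup; exact: mpre.
Qed.

HB.instance Definition _ := isMeasure.Build _ _ _ cons_measure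
  cons_measure0 cons_measure_ge0 cons_measure_sigma_additive.

Let cons_measure_sigma_finite : sigma_finite [set: n.+1.-tuple R] cons_measure.
Proof.
have /sigma_finiteP[F [TF ndF Foo]] := sigma_finiteT (@lebesgue_measure R).
have /sigma_finiteP[G [TG ndG Goo]] := sigma_finiteT nu.
exists (fun k => (fun t : n.+1.-tuple R => tnth t ord0) @^-1` F k `&`
                 (fun t : n.+1.-tuple R => [tuple of behead t]) @^-1` G k).
  apply/seteqP; split=> // t _.
  have [i _ Fi] : (\bigcup_k F k) (tnth t ord0) by rewrite -TF.
  have [j _ Gj] : (\bigcup_k G k) [tuple of behead t] by rewrite -TG.
  exists (maxn i j) => //; split.
    exact: (subsetPset _ _ (ndF _ _ (leq_maxl i j))).
  exact: (subsetPset _ _ (ndG _ _ (leq_maxr i j))).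
move=> k; have [mF Fk] := Foo k; have [mG Gk] := Goo k; split.
  apply: measurableI.
    rewrite -[X in measurable X]setTI; exact: (measurable_tnth ord0).
  rewrite -[X in measurable X]setTI; exact: measurable_behead.
rewrite /cons_measure /pushforward.
rewrite [X in (_ \x _) X](_ : _ = F k `*` G k).
  by rewrite product_measure1E// lte_mul_pinfty// ge0_fin_numE.
by apply/seteqP; split=> -[x t] [] /= Fx; rewrite (_ : [tuple of _] = t)//;
  apply/val_inj.
Qed.

HB.instance Definition _ :=
  Measure_isSigmaFinite.Build _ _ _ cons_measure cons_measure_sigma_finite.

End cons_measure.

Fixpoint lebesgue_tuple (n : nat) :
    {sigma_finite_measure set (n.-tuple R) -> \bar R} :=
  match n with
  | 0 => \d_([tuple] : 0.-tuple R)
  | n'.+1 => cons_measure (lebesgue_tuple n')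
  end.

End lebesgue_tuple.

Section gaussian.
Context {R : realType} {m : nat}.

Definition gaussian_density (mu : 'rV[R]_m) (K : 'M[R]_m) (x : m.-tuple R) : R :=
  let y := \row_i tnth x i - mu in
  (Num.sqrt ((2 * pi) ^+ m * \det K))^-1 *
  expR (- (y *m invmx K *m y^T) 0 0 / 2).

(* The law of (X_1, ..., X_m) is N(mu, K) for some mean vector mu and some
   nonsingular K; that K is the covariance matrix is left as a consequence.
   Degenerate Gaussian vectors, which have a singular covariance matrix, are
   left out. *)
Definition jointly_gaussian {d : measure_display} {Omega : measurableType d}
    (P : probability Omega R) (X : 'I_m -> {RV P >-> R}) : Prop :=
  exists (mu : 'rV[R]_m) (K : 'M[R]_m), posdefmx K /\
    forall A : set (m.-tuple R), measurable A ->
      distribution P (rvector X) A =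
      (\int[lebesgue_tuple m]_(x in A) (gaussian_density mu K x)%:E)%E.

End gaussian.

(* Main.v *)
Require Import Defs.
From HB Require Import structures.
From mathcomp Require Import all_boot all_order all_algebra.
From mathcomp Require Import all_classical all_reals all_analysis.
From mathcomp Require Import measurable_realfun ring lra.

(** Lower bound. Let M_j = E[X_j - mu_j | U] and N = E[M^T M]. Conditional
    independence makes Sigma - N = Lam diagonal, and N >= 0. The Donsker-Varadhan
    inequality, tested with the logarithm of the ratio of the density of
    N(mu + M(U), D) to that of X, gives
      I(U; X) >= ln (|Sigma| / |D|) / 2 - tr (D^-1 Lam) / 2 + m / 2
    for all diagonal D > 0, without any disintegration of the law of X given U.
    As Lam may be singular, D is (1 - t) Lam + t c 1 with c 1 <= Sigma, and t
    tends to 0.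

    Upper bound. After replacing Lam by (1 - t) Lam, the matrix G = Sigma - Lam is
    invertible. The auxiliary variable U is produced from X by the backward channel
    U | X = y ~ N((y - mu) Sigma^-1 G, (G^-1 + Lam^-1)^-1). By completing the
    square, this is the Gaussian channel X | U = u ~ N(mu + u, Lam), under which the
    coordinates of X are independent; its mutual information is computed from the
    density ratio.

    The only information on Gaussian integrals that is needed is the normalisation
    of the one-dimensional density: moments follow from the moment generating
    function, which translation invariance of the Lebesgue measure determines from
    the total mass. *)

Set Implicit Arguments.
Unset Strict Implicit.
Unset Printing Implicit Defensive.

Import Order.TTheory GRing.Theory Num.Theory.
Import numFieldNormedType.Exports.

Local Open Scope classical_set_scope.
Local Open Scope ring_scope.

(** * Integration *)

(** The usual converse bounds the conditional differential entropy of X given U by that of a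
    Gaussian, which calls for conditional densities. The variational inequality avoids them: for
    each fixed u the exponential of the test function turns the density of X into a Gaussian density
    with diagonal covariance D, so its integral against the product law is exactly 1, and in the
    expectation of the test function only second moments survive. Over D the resulting bound is best
    at D = Lam, where the trace term equals m and cancels m / 2; a nearby D costs little, and
    choosing D itself feasible allows a direct comparison with the infimum.

    In the upper bound U is built from X, rather than X from U, so that the law of X is exact by
    construction and no convolution of Gaussians is computed. The normalising constant of the
    backward kernel is only shown to be finite and positive; it drops out of the density ratio.
    Since positivity of |Sigma| is read off from the total mass 1 of the law of X, explicit
    normalisation is needed for diagonal covariances only, and no linear change of variables
    occurs. *)

Section integral_extension.
Local Open Scope ereal_scope.
Context {R : realType}.

Import HBNNSimple.

Lemma integral_mul_nnsfun d d' (Omega : measurableType d) (T : measurableType d')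
    (mu : {measure set Omega -> \bar R}) (X : Omega -> T) (F : Omega -> \bar R)
    (h : {nnsfun T >-> R}) :
  measurable_fun setT X -> measurable_fun setT F -> (forall w, 0 <= F w) ->
  \int[mu]_w (F w * (h (X w))%:E) =
  \sum_(k \in range h) (k%:E * \int[mu]_(w in X @^-1` (h @^-1` [set k])) F w).
Proof.
move=> mX mF F0.
have mXk k : measurable (X @^-1` (h @^-1` [set k])).
  rewrite -[X in measurable X]setTI; apply: mX => //.
have E w : F w * (h (X w))%:E =
    \sum_(k \in range h) (k%:E * (F \_ (X @^-1` (h @^-1` [set k]))) w).
  rewrite [in LHS]fimfunE -fsumEFin// ge0_mule_fsumr; last first.
    by move=> k; rewrite EFinM nnfun_muleindic_ge0.
  apply: eq_fsbigr => k _; rewrite patchE indicE EFinM.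
  have -> : (w \in X @^-1` (h @^-1` [set k])) = (X w \in h @^-1` [set k]).
    by apply/idP/idP; rewrite !inE.
  by case: ifP => _; rewrite ?mule1 ?mule0 // muleC.
under eq_integral do rewrite E.
have pos k w : 0 <= (k%:E * (F \_ (X @^-1` (h @^-1` [set k]))) w).
  rewrite patchE; case: ifPn => [|_]; last by rewrite mule0.
  rewrite inE /= => <-; apply: mule_ge0 => //; rewrite lee_fin//.
rewrite ge0_integral_fsum//; last first.
  move=> k; apply: emeasurable_funM => //.
  by apply/(measurable_restrictT _ _).1 => //; exact: measurable_funTS.
apply: eq_fsbigr => k /[!inE] -[t _ <-].
rewrite ge0_integralZl//.
- by rewrite [in RHS]integral_mkcond.
- by apply/(measurable_restrictT _ _).1 => //; exact: measurable_funTS.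
- by move=> w _; rewrite patchE; case: ifPn.
- by rewrite lee_fin.
Qed.

(** Extension from indicators to simple functions by linearity, then by monotone convergence. Two
    source spaces with separate weights are allowed, so that one statement serves both for changes
    of density (identity maps) and for conditional expectations (maps such as U on one space). *)
Lemma ge0_integral_ext d1 d2 d (O1 : measurableType d1) (O2 : measurableType d2)
    (T : measurableType d)
    (mu1 : {measure set O1 -> \bar R}) (mu2 : {measure set O2 -> \bar R})
    (X1 : O1 -> T) (X2 : O2 -> T) (F1 : O1 -> R) (F2 : O2 -> R) :
  measurable_fun setT X1 -> measurable_fun setT X2 ->
  measurable_fun setT F1 -> measurable_fun setT F2 ->
  (forall w, 0 <= F1 w)%R -> (forall w, 0 <= F2 w)%R ->
  (forall B, measurable B -> \int[mu1]_(w in X1 @^-1` B) (F1 w)%:E =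
                             \int[mu2]_(w in X2 @^-1` B) (F2 w)%:E) ->
  forall phi : T -> \bar R, measurable_fun setT phi -> (forall t, 0 <= phi t) ->
  \int[mu1]_w ((F1 w)%:E * phi (X1 w)) = \int[mu2]_w ((F2 w)%:E * phi (X2 w)).
Proof.
move=> mX1 mX2 mF1 mF2 F10 F20 E phi mphi phi0.
pose h := nnsfun_approx measurableT mphi.
have lim d0 (O : measurableType d0) (mu : {measure set O -> \bar R})
    (X : O -> T) (F : O -> R) : measurable_fun setT X ->
    measurable_fun setT F -> (forall w, 0 <= F w)%R ->
    \int[mu]_w ((F w)%:E * phi (X w)) = limn (fun n => \int[mu]_w ((F w)%:E * (h n (X w))%:E)).
  move=> mX mF F0; rewrite -monotone_convergence//.
  - apply: eq_integral => w _; apply/esym/cvg_lim => //.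
    by apply: cvgeZl => //; exact: cvg_nnsfun_approx.
  - move=> n; apply: emeasurable_funM => //; first exact/measurable_EFinP.
    exact/measurable_EFinP/measurableT_comp.
  - by move=> n w _; apply: mule_ge0 => //; rewrite lee_fin.
  - move=> w _ a b ab; apply: lee_wpmul2l; rewrite lee_fin//.
    exact/lefP/nd_nnsfun_approx.
rewrite (lim _ _ mu1 X1)// (lim _ _ mu2 X2)//; congr (limn _).
apply/funext => n; rewrite (integral_mul_nnsfun mu1 (F := EFin \o F1))//; [|exact/measurable_EFinP].
rewrite (integral_mul_nnsfun mu2 (F := EFin \o F2))//; [|exact/measurable_EFinP].
by apply: eq_fsbigr => k _; rewrite E.
Qed.

End integral_extension.

(** * Measures given by a density *)

Section density.
Local Open Scope ereal_scope.
Context {R : realType} {d : measure_display} {T : measurableType d}.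

Lemma ge0_integral_density (M mu : {measure set T -> \bar R}) (f : T -> R) :
  measurable_fun setT f -> (forall x, 0 <= f x)%R ->
  (forall A, measurable A -> M A = \int[mu]_(x in A) (f x)%:E) ->
  forall phi : T -> \bar R, measurable_fun setT phi -> (forall t, 0 <= phi t) ->
  \int[M]_x phi x = \int[mu]_x ((f x)%:E * phi x).
Proof.
move=> mf f0 E phi mphi phi0.
rewrite -(@ge0_integral_ext _ _ _ _ _ _ _ M mu id id (cst 1%R) f)//.
  by under [RHS]eq_integral do rewrite mul1e.
by move=> B mB; rewrite -E// -[RHS]mul1e -integral_cst.
Qed.

Variables (mu : {measure set T -> \bar R}) (f : T -> R).
Hypotheses (mf : measurable_fun setT f) (f0 : forall x, (0 <= f x)%R).
Hypothesis f1 : \int[mu]_x (f x)%:E = 1.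

(** The hypotheses on [f] are arguments of the constant so that the measure and probability
    instances can be attached to it. *)
Definition density_measure of measurable_fun setT f & (forall x, (0 <= f x)%R) &
  \int[mu]_x (f x)%:E = 1 := fun A => \int[mu]_(x in A) (f x)%:E.

Local Notation nu := (density_measure mf f0 f1).

Let nu0 : nu set0 = 0. Proof. exact: integral_set0. Qed.

Let nu_ge0 A : 0 <= nu A.
Proof. by apply: integral_ge0 => x _; rewrite lee_fin. Qed.

Let nu_sigma_additive : semi_sigma_additive nu.
Proof.
move=> A mA tA mUA; rewrite /density_measure ge0_integral_bigcup//; last 2 first.
- by apply: measurable_funTS; exact/measurable_EFinP.
- by move=> x _; rewrite lee_fin.
apply: is_cvg_ereal_nneg_natsum_cond => n _ _.
by apply: integral_ge0 => x _; rewrite lee_fin.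
Qed.

HB.instance Definition _ := isMeasure.Build _ _ _ nu nu0 nu_ge0 nu_sigma_additive.

HB.instance Definition _ := Measure_isProbability.Build _ _ _ nu f1.

Definition density_probability : probability T R := nu.

End density.

(** * Lebesgue measure on tuples: Tonelli, translations, products *)

Section lebesgue_tuple_theory.
Context {R : realType}.

(** The image of Lebesgue measure under a translation gives every half-open interval its length,
    hence is Lebesgue measure by uniqueness. *)
Lemma ge0_integral_translation (f : R -> \bar R) (a : R) :
  measurable_fun setT f -> (forall x, 0 <= f x)%E ->
  (\int[@lebesgue_measure R]_x f (x + a)%R = \int[@lebesgue_measure R]_x f x)%E.
Proof.
move=> mf f0.
have ma : measurable_fun setT ((fun x => x + a) : measurableTypeR R -> measurableTypeR R).
  exact: measurable_funD.
rewrite -[LHS](@ge0_integral_pushforward _ _ _ _ _ _ ma lebesgue_measure setT f)//.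
apply: eq_measure_integral => A mA _.
apply/esym/lebesgue_measure_unique => // _ [[u v] _ <-].
rewrite /= /pushforward.
rewrite (_ : _ @^-1` _ = `](u - a), (v - a)]%classic); last first.
  by apply/seteqP; split => x /=; rewrite !in_itv/= ltrBlDr lerBrDr.
by rewrite !lebesgue_measure_itv/= !lte_fin ltrD2r -!EFinD opprB addrA subrK.
Qed.

Lemma lebesgue_tuple_recl n (f : n.+1.-tuple R -> \bar R) :
  measurable_fun setT f -> (forall t, 0 <= f t)%E ->
  (\int[lebesgue_tuple n.+1]_t f t =
   \int[@lebesgue_measure R]_x \int[lebesgue_tuple n]_t f (Defs.cons_tuple (x, t)))%E.
Proof.
move=> mf f0 /=.
have mc : measurable_fun [set: measurableTypeR R * n.-tuple R] (@Defs.cons_tuple R n).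
  exact: (measurable_cons measurable_fst measurable_snd).
rewrite [LHS](@ge0_integral_pushforward _ _ _ _ _ _ mc
   (lebesgue_measure \x lebesgue_tuple n)%E setT f)//.
rewrite preimage_setT fubini_tonelli1//.
  exact: measurableT_comp.
by move=> x; exact: f0.
Qed.

Definition shift_tuple n (a : 'rV[R]_n) (t : n.-tuple R) : n.-tuple R :=
  [tuple tnth t i + a 0 i | i < n].

Lemma measurable_shift_tuple n (a : 'rV[R]_n) :
  measurable_fun setT (shift_tuple a).
Proof.
apply/measurable_fun_tnthP => i.
rewrite (_ : _ \o _ = fun t => tnth t i + a 0 i).
  by apply: measurable_funD => //; exact: measurable_tnth.
by apply/funext => t /=; rewrite tnth_mktuple.
Qed.

Lemma lebesgue_tuple_translation n (a : 'rV[R]_n) (f : n.-tuple R -> \bar R) :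
  measurable_fun setT f -> (forall t, 0 <= f t)%E ->
  (\int[lebesgue_tuple n]_t f (shift_tuple a t) = \int[lebesgue_tuple n]_t f t)%E.
Proof.
elim: n a f => [|n IH] a f mf f0.
  by apply: eq_integral => t _; congr f; rewrite tuple0 [RHS]tuple0.
rewrite lebesgue_tuple_recl; last 2 first.
- by apply: measurableT_comp => //; exact: measurable_shift_tuple.
- by move=> t; exact: f0.
rewrite lebesgue_tuple_recl//.
have mc x : measurable_fun setT (fun t => Defs.cons_tuple (x, t) : n.+1.-tuple R).
  have := measurable_cons (measurable_cst x) (@measurable_id _ (n.-tuple R) setT); exact.
have E x t : shift_tuple a (Defs.cons_tuple (x, t)) =
    Defs.cons_tuple (x + a 0 0, shift_tuple (\row_i a 0 (lift ord0 i)) t).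
  apply: eq_from_tnth => i; rewrite tnth_mktuple.
  have [j ->|->] := unliftP ord0 i.
    by rewrite !tnthS tnth_mktuple mxE.
  by rewrite !tnth0.
under eq_integral do under eq_integral do rewrite E.
under eq_integral => x _.
  rewrite (IH _ (fun t => f (Defs.cons_tuple (x + a 0 0, t))))//; last first.
    exact: measurableT_comp (mc _).
  over.
rewrite (ge0_integral_translation (f := fun x => (\int[lebesgue_tuple n]_t f (Defs.cons_tuple (x, t)))%E))//.
- apply: (measurable_fun_fubini_tonelli_F (fun p => f (Defs.cons_tuple p))) => //.
  apply: measurableT_comp => //.
  exact: (measurable_cons measurable_fst measurable_snd).
- by move=> x; exact: integral_ge0.
Qed.

Lemma lebesgue_tuple_prod n (f : 'I_n -> R -> R) (c : 'I_n -> R) :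
  (forall i, measurable_fun setT (f i)) -> (forall i x, 0 <= f i x) ->
  (forall i, \int[@lebesgue_measure R]_x (f i x)%:E = (c i)%:E)%E ->
  (\int[lebesgue_tuple n]_t (\prod_i f i (tnth t i))%:E = (\prod_i c i)%:E)%E.
Proof.
elim: n f c => [|n IH] f c mf f0 fc.
  under eq_integral do rewrite big_ord0.
  (* In dimension 0 the measure is a Dirac mass, of total mass 1. *)
  rewrite big_ord0 integral_cst// mul1e; exact: diracT.
rewrite lebesgue_tuple_recl//; last 2 first.
- apply/measurable_EFinP/measurable_prod => i _.
  by apply: measurableT_comp => //; exact: measurable_tnth.
- by move=> t; rewrite lee_fin; exact: prodr_ge0.
have mprod : measurable_fun setT
    (fun t : n.-tuple R => (\prod_(i < n) f (lift ord0 i) (tnth t i))%:E).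
  apply/measurable_EFinP/measurable_prod => i _.
  by apply: measurableT_comp => //; exact: measurable_tnth.
have E x : (\int[lebesgue_tuple n]_t
    (\prod_i f i (tnth (Defs.cons_tuple (x, t)) i))%:E =
    (f ord0 x)%:E * (\prod_i c (lift ord0 i))%:E)%E.
  rewrite -(IH (fun i => f (lift ord0 i)) (fun i => c (lift ord0 i)))//.
  rewrite -ge0_integralZl ?lee_fin//; last first.
    by move=> t _; rewrite lee_fin; exact: prodr_ge0.
  apply: eq_integral => t _; rewrite big_ord_recl EFinM tnth0.
  congr (_ * _%:E)%E; apply: eq_bigr => i _; congr (f _ _); exact: tnthS.
under eq_integral do rewrite E.
rewrite ge0_integralZr//; last 2 first.
- by move=> t _; rewrite lee_fin.
- rewrite lee_fin; apply: prodr_ge0 => i _.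
  by rewrite -lee_fin -fc; apply: integral_ge0 => x _; rewrite lee_fin.
by rewrite fc -EFinM [in RHS]big_ord_recl.
by apply/measurable_EFinP; exact: (mf ord0).
Qed.

End lebesgue_tuple_theory.

(** * Moments from the moment generating function *)

Section exponential_bounds.
Context {R : realType}.
Implicit Types x s : R.

Lemma expR_sub1_le x : expR x - 1 <= x * expR x.
Proof.
have := expR_ge1Dx (- x); rewrite -(ler_pM2r (expR_gt0 x)) -expRD addNr expR0.
lra.
Qed.

Lemma expR_taylor1 x : `|expR x - 1 - x| <= x ^+ 2 * expR `|x|.
Proof.
rewrite ger0_norm; last by have := expR_ge1Dx x; lra.
have h := expR_sub1_le x; have h1 := expR_ge1Dx x.
have [x0|x0] := lerP 0 x.
  rewrite (ger0_norm x0); have h2 : x * (expR x - 1) <= x * (x * expR x) by apply: ler_wpM2l.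
  lra.
rewrite (ltr0_norm x0); have h2 : 1 <= expR (- x) by rewrite -expR0 ler_expR; lra.
have h3 : - x * (1 - expR x) <= - x * - x by apply: ler_wpM2l; lra.
have h4 : x ^+ 2 * 1 <= x ^+ 2 * expR (- x) by apply: ler_wpM2l => //; exact: sqr_ge0.
nra.
Qed.

Lemma expR_cosh_bound x :
  `|expR x + expR (- x) - 2 - x ^+ 2| <= `|x| ^+ 3 * expR `|x|.
Proof.
wlog x0 : x / 0 <= x.
  move=> H; have [/H//|x0] := lerP 0 x.
  have := H (- x); rewrite opprK normrN sqrrN (addrC (expR (- x))); apply.
  by rewrite oppr_ge0 ltW.
rewrite (ger0_norm x0).
have a1 := expR_ge1Dx x; have a2 := expR_sub1_le x.
have b1 := expR_ge1Dx (- x); have b2 := expR_sub1_le (- x).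
have ep := expR_gt0 x; have en := expR_gt0 (- x).
have ee : expR x * expR (- x) = 1 by rewrite -expRD subrr expR0.
set e := expR x in a1 a2 ep ee *; set f := expR (- x) in b1 b2 en ee *.
(* The factorisation rests on [e * f = 1]. The first factor lies between [x] and [x * e], the second
   between [x * f] and [x]. *)
have -> : e + f - 2 = (e - 1) * (1 - f) by rewrite mulrBl mulrBr ee; lra.
have f1 : f <= 1 by rewrite -expR0 ler_expR oppr_le0.
have xf : 0 <= x * f by rewrite mulr_ge0// ltW.
have ab1 : (e - 1) * (1 - f) <= (x * e) * x by apply: ler_pM; lra.
have ab2 : x * (x * f) <= (e - 1) * (1 - f).
  by apply: ler_pM => //; lra.
have c1 : x ^+ 2 * (e - 1) <= x ^+ 2 * (x * e) by rewrite ler_wpM2l// sqr_ge0.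
have c2 : x ^+ 2 * (1 - f) <= x ^+ 2 * x by rewrite ler_wpM2l// ?sqr_ge0//; lra.
have c3 : x ^+ 3 * 1 <= x ^+ 3 * e by rewrite ler_wpM2l// ?exprn_ge0//; lra.
rewrite ler_norml; apply/andP; split; nra.
Qed.

Lemma expR_norm_le x : expR `|x| <= expR x + expR (- x).
Proof.
by have [x0|x0] := lerP 0 x;
  rewrite ?(ger0_norm x0) ?(ltr0_norm x0) ?lerDl ?lerDr expR_ge0.
Qed.

(** The constant is 3^3: cube |x|/3 <= exp(|x|/3). *)
Lemma cube_expR_le x : `|x| ^+ 3 * expR `|x| <= 27 * (expR (2 * x) + expR (- (2 * x))).
Proof.
have h : `|x| / 3 <= expR (`|x| / 3) by have := expR_ge1Dx (`|x| / 3); lra.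
have h3 : (`|x| / 3) ^+ 3 <= expR (`|x| / 3) ^+ 3.
  by rewrite lerXn2r// nnegrE ?expR_ge0// divr_ge0.
rewrite -expRM_natl mulrCA divff// mulr1 in h3.
have h4 : `|x| ^+ 3 * expR `|x| <= 27 * expR `|x| * expR `|x|.
  apply: ler_wpM2r; [exact: expR_ge0|lra].
apply: (le_trans h4); rewrite -mulrA -expRD ler_pM2l//.
have -> : `|x| + `|x| = `|2 * x| by rewrite normrM ger0_norm//; lra.
exact: expR_norm_le.
Qed.

(** Squaring |x|/2 <= exp(|x|/2) gives the constant 4; it is relaxed to 27 so that the same
    dominating function as for the cube applies. *)
Lemma sqr_expR_le x : x ^+ 2 * expR `|x| <= 27 * (expR (2 * x) + expR (- (2 * x))).
Proof.
have h : `|x| / 2 <= expR (`|x| / 2) by have := expR_ge1Dx (`|x| / 2); lra.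
have h3 : (`|x| / 2) ^+ 2 <= expR (`|x| / 2) ^+ 2.
  by rewrite lerXn2r// nnegrE ?expR_ge0// divr_ge0.
rewrite -expRM_natl mulrCA divff// mulr1 in h3.
have e0 := expR_gt0 `|x|.
have h4 : x ^+ 2 * expR `|x| <= 27 * expR `|x| * expR `|x|.
  by rewrite -real_normK ?num_real//; apply: ler_wpM2r; [exact: expR_ge0|lra].
apply: (le_trans h4); rewrite -mulrA -expRD ler_pM2l//.
have -> : `|x| + `|x| = `|2 * x| by rewrite normrM ger0_norm//; lra.
exact: expR_norm_le.
Qed.

(** Replaces differentiation under the integral sign at s = 0: the moments are extracted from bounds
    of order s valid for all small s. *)
Lemma le_small_eq0 (a C : R) : 0 <= C ->
  (forall s, 0 < s -> s <= 1 -> `|a| <= s * C) -> a = 0.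
Proof.
move=> C0 H; apply/eqP; rewrite -normr_eq0 eq_le normr_ge0 andbT.
apply/ler_addgt0Pl => e e0; rewrite addr0.
have C1 : 0 < C + 1 by lra.
pose s := Num.min 1 (e / (C + 1)).
have s0 : 0 < s by rewrite lt_min ltr01 divr_gt0.
have s1 : s <= 1 by rewrite ge_min lexx.
apply: (le_trans (H s s0 s1)).
have : s <= e / (C + 1) by rewrite ge_min lexx orbT.
by rewrite ler_pdivlMr//; nra.
Qed.

End exponential_bounds.

Section moments.
Context {R : realType} {d : measure_display} {T : measurableType d}.
Variable P : probability T R.

Lemma integrable_le (f g : T -> R) : measurable_fun setT f ->
  P.-integrable setT (EFin \o g) -> (forall x, `|f x| <= g x) ->
  P.-integrable setT (EFin \o f).
Proof.
move=> mf ig fg; apply: (le_integrable _ _ _ ig) => //.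
  exact/measurable_EFinP.
move=> x _ /=; rewrite lee_fin (le_trans (fg x))//.
exact: ler_norm.
Qed.

Lemma integrable_addR (f g : T -> R) : P.-integrable setT (EFin \o f) ->
  P.-integrable setT (EFin \o g) ->
  P.-integrable setT (EFin \o (fun x => f x + g x)).
Proof. by move=> fi gi; have := integrableD measurableT fi gi. Qed.

Lemma integrable_subR (f g : T -> R) : P.-integrable setT (EFin \o f) ->
  P.-integrable setT (EFin \o g) ->
  P.-integrable setT (EFin \o (fun x => f x - g x)).
Proof. by move=> fi gi; have := integrableB measurableT fi gi. Qed.

Lemma integrable_scaleR (c : R) (f : T -> R) : P.-integrable setT (EFin \o f) ->
  P.-integrable setT (EFin \o (fun x => c * f x)).
Proof. by move=> fi; have := integrableZl measurableT c fi. Qed.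

Lemma integrable_cstR (c : R) : P.-integrable setT (EFin \o (fun=> c)).
Proof. exact: finite_measure_integrable_cst. Qed.

Lemma integral_probability_cst (c : R) : (\int[P]_x c%:E = c%:E)%E.
Proof.
rewrite integral_cst//; set p := (X in (_ * X)%E).
have -> : p = 1%E by exact: probability_setT.
by rewrite mule1.
Qed.

Lemma Rintegral_probability_cst (c : R) : \int[P]_x c = c.
Proof. by rewrite /Rintegral integral_probability_cst. Qed.

Variables (Z : T -> R) (v : R).
Hypothesis mZ : measurable_fun setT Z.
Hypothesis mgf : forall s, (\int[P]_x (expR (s * Z x))%:E = (expR (s ^+ 2 * v / 2))%:E)%E.

Let mexp s : measurable_fun setT (fun x => expR (s * Z x)).
Proof. by apply: measurableT_comp => //; exact: measurable_funM. Qed.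

Let iexp s : P.-integrable setT (EFin \o (fun x => expR (s * Z x))).
Proof.
apply/integrableP; split; first exact/measurable_EFinP.
under eq_integral do rewrite /= ger0_norm ?expR_ge0//.
by rewrite mgf ltry.
Qed.

(** Dominates [Z ^+ 2], and both Taylor remainders uniformly in 0 < s <= 1; it is integrable by the
    generating function at 2 and -2. *)
Let B x := 27 * (expR (2 * Z x) + expR (- (2 * Z x))).

Let iB : P.-integrable setT (EFin \o B).
Proof.
apply/integrable_scaleR/integrable_addR; first exact: iexp.
by have := iexp (-2); apply: eq_integrable => // x _ /=; rewrite mulNr.
Qed.

Let one_le_exp x : 1 <= expR `|Z x|.
Proof. by rewrite -expR0 ler_expR. Qed.

Lemma mgf_integrable_sqr : P.-integrable setT (EFin \o (fun x => Z x ^+ 2)).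
Proof.
apply: (@integrable_le _ B) => //; first exact: measurable_funX.
move=> x; rewrite ger0_norm ?sqr_ge0//; apply: le_trans (sqr_expR_le _).
by rewrite -[leLHS]mulr1 ler_wpM2l ?sqr_ge0 ?one_le_exp.
Qed.

Lemma mgf_integrable : P.-integrable setT (EFin \o Z).
Proof.
apply: (@integrable_le _ (fun x => 1 + Z x ^+ 2)) => //.
  by apply: integrable_addR; [exact: integrable_cstR|exact: mgf_integrable_sqr].
move=> x; rewrite ler_norml; apply/andP; split; nra.
Qed.

Let C := \int[P]_x B x.

Let C0 : 0 <= C.
Proof. by apply: Rintegral_ge0 => x _; rewrite mulr_ge0// addr_ge0// expR_ge0. Qed.

Let norm_int_le (f : T -> R) (s : R) : measurable_fun setT f ->
  P.-integrable setT (EFin \o f) ->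
  (forall x, `|f x| <= s * B x) -> `|\int[P]_x f x| <= s * C.
Proof.
move=> mf fi fB; apply: (le_trans (le_normr_Rintegral measurableT fi)).
rewrite -RintegralZl//; apply: le_Rintegral => //.
  by have := integrable_norm fi.
by have := integrableZl measurableT s iB.
Qed.

Let expZ s : \int[P]_x expR (s * Z x) = expR (s ^+ 2 * v / 2).
Proof. by rewrite /Rintegral mgf. Qed.

Let scale_le s x : 0 < s -> s <= 1 -> expR `|s * Z x| <= expR `|Z x|.
Proof.
move=> s0 s1; rewrite ler_expR normrM (gtr0_norm s0).
by rewrite ler_piMl.
Qed.

(** The generating function is even in s, so the two exponentials in [f] cancel under the integral
    and leave -2 s E[Z], while the Taylor remainder is of order s^2. *)
Lemma mgf_mean : \int[P]_x Z x = 0.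
Proof.
apply: (@le_small_eq0 _ _ C) => //.
move=> s s0 s1.
pose f x := expR (s * Z x) - expR (- s * Z x) - 2 * s * Z x.
have i1 : P.-integrable setT (EFin \o (fun x => expR (s * Z x) - expR (- s * Z x))).
  by apply: integrable_subR; exact: iexp.
have i2 : P.-integrable setT (EFin \o (fun x => 2 * s * Z x)).
  exact/integrable_scaleR/mgf_integrable.
have fi : P.-integrable setT (EFin \o f) by exact: integrable_subR.
have Ef : \int[P]_x f x = - (2 * s) * \int[P]_x Z x.
  rewrite RintegralB// RintegralB ?iexp// !expZ sqrrN subrr sub0r.
  by rewrite RintegralZl ?mulNr//; exact: mgf_integrable.
have := norm_int_le (s := 2 * s ^+ 2) _ fi.
rewrite Ef normrM normrN (ger0_norm (x := 2 * s)); last by lra.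
have mf : measurable_fun setT f by apply/measurable_EFinP; exact: measurable_int fi.
move=> /(_ mf) H.
have : 2 * s * `|\int[P]_x Z x| <= 2 * s ^+ 2 * C.
  apply: H => x.
  have h1 := expR_taylor1 (s * Z x); have h2 := expR_taylor1 (- s * Z x).
  have -> : f x = (expR (s * Z x) - 1 - s * Z x) - (expR (- s * Z x) - 1 - (- s * Z x)).
    by rewrite /f; lra.
  apply: (le_trans (ler_normB _ _)); apply: (le_trans (lerD h1 h2)).
  rewrite mulNr sqrrN normrN.
  suff : (s * Z x) ^+ 2 * expR `|s * Z x| <= s ^+ 2 * B x by lra.
  rewrite exprMn -mulrA ler_pM2l ?exprn_gt0//; apply: le_trans (sqr_expR_le _).
  by rewrite ler_wpM2l ?sqr_ge0// scale_le.
by move=> ?; rewrite -(@ler_pM2l _ (2 * s)) ?mulr_gt0//; lra.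
Qed.

(** The even combination [f] has an integral of order s^3, and this integral equals s^2 (v - E[Z^2])
    up to another term of order s^3. *)
Lemma mgf_variance : \int[P]_x (Z x ^+ 2) = v.
Proof.
apply/esym/eqP; rewrite -subr_eq0; apply/eqP.
(* For 0 < s <= 1, s^3 D bounds the difference between 2 (exp(s^2 v / 2) - 1) and s^2 v. *)
pose D := v ^+ 2 * expR `|v|.
have D0 : 0 <= D by rewrite mulr_ge0 ?sqr_ge0 ?expR_ge0.
apply: (@le_small_eq0 _ _ (C + D)); first exact: addr_ge0.
move=> s s0 s1.
pose f x := expR (s * Z x) + expR (- s * Z x) - 2 - s ^+ 2 * Z x ^+ 2.
have i1 : P.-integrable setT (EFin \o (fun x => expR (s * Z x) + expR (- s * Z x))).
  by apply: integrable_addR; exact: iexp.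
have i2 : P.-integrable setT (EFin \o (fun x => s ^+ 2 * Z x ^+ 2)).
  exact/integrable_scaleR/mgf_integrable_sqr.
have i3 : P.-integrable setT (EFin \o (fun _ => 2 : R)).
  exact: integrable_cstR.
have i4 : P.-integrable setT (EFin \o (fun x => expR (s * Z x) + expR (- s * Z x) - 2)).
  exact: integrable_subR.
have fi : P.-integrable setT (EFin \o f) by exact: integrable_subR.
have Ef : \int[P]_x f x = 2 * expR (s ^+ 2 * v / 2) - 2 - s ^+ 2 * \int[P]_x (Z x ^+ 2).
  rewrite RintegralB// RintegralB// RintegralD ?iexp// !expZ sqrrN.
  rewrite Rintegral_probability_cst RintegralZl//; last exact: mgf_integrable_sqr.
  by lra.
have mf : measurable_fun setT f by apply/measurable_EFinP; exact: measurable_int fi.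
have H : `|\int[P]_x f x| <= s ^+ 3 * C.
  apply: norm_int_le => // x; rewrite /f mulNr -exprMn.
  apply: (le_trans (expR_cosh_bound _)).
  rewrite normrM exprMn (gtr0_norm s0) -mulrA ler_pM2l ?exprn_gt0//.
  apply: le_trans (cube_expR_le _).
  by rewrite ler_wpM2l ?exprn_ge0// ler_expR ler_piMl.
have H2 := expR_taylor1 (s ^+ 2 * v / 2).
have H3 : (s ^+ 2 * v / 2) ^+ 2 * expR `|s ^+ 2 * v / 2| <= s ^+ 3 * D / 2.
  have e1 : expR `|s ^+ 2 * v / 2| <= expR `|v|.
    rewrite ler_expR -mulrA mulrCA normrM ler_piMr// ger0_norm; last first.
      by rewrite mulr_ge0 ?sqr_ge0.
    nra.
  have e0 : 0 <= (s ^+ 2 * v / 2) ^+ 2 by exact: sqr_ge0.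
  apply: (le_trans (ler_wpM2l e0 e1)).
  have -> : (s ^+ 2 * v / 2) ^+ 2 * expR `|v| = s ^+ 3 * (s / 4) * D by rewrite /D; field.
  rewrite -[leRHS]mulrA mulrAC -[leRHS]mulrA [leRHS]mulrCA mulrC -mulrA mulrC.
  have s30 : 0 <= s ^+ 3 * D by rewrite mulr_ge0// exprn_ge0// ltW.
  nra.
rewrite Ef in H.
have s2 : 0 < s ^+ 2 by rewrite exprn_gt0.
rewrite -(@ler_pM2l _ (s ^+ 2))// -[X in X * _ <= _](gtr0_norm s2) -normrM.
move: H H2; rewrite !ler_norml => /andP[h1 h2] /andP[h3 h4].
by apply/andP; split; nra.
Qed.

End moments.

(** * Quadratic forms and Gaussian moments *)

Section bilinear_forms.
Context {R : realType} {n : nat}.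
Implicit Types (M A : 'M[R]_n) (y z u : 'rV[R]_n).

Definition bform M y z : R := (y *m M *m z^T) 0 0.

Lemma bformE M y z : bform M y z = \sum_i \sum_j y 0 i * M i j * z 0 j.
Proof.
rewrite /bform mxE exchange_big /=; apply: eq_bigr => j _.
by rewrite !mxE big_distrl.
Qed.

Lemma bformDl M y y' z : bform M (y + y') z = bform M y z + bform M y' z.
Proof. by rewrite /bform !mulmxDl mxE. Qed.

Lemma bformNl M y z : bform M (- y) z = - bform M y z.
Proof. by rewrite /bform !mulNmx mxE. Qed.

Lemma bformZl M c y z : bform M (c *: y) z = c * bform M y z.
Proof. by rewrite /bform -!scalemxAl mxE. Qed.

Lemma bform_tr M y z : bform M y z = bform M^T z y.
Proof.
transitivity ((y *m M *m z^T)^T 0 0); first by rewrite [RHS]mxE.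
by rewrite trmx_mul trmxK trmx_mul mulmxA.
Qed.

Lemma bformC M y z : M^T = M -> bform M y z = bform M z y.
Proof. by move=> sM; rewrite bform_tr sM. Qed.

Lemma bformDr M y z z' : bform M y (z + z') = bform M y z + bform M y z'.
Proof. by rewrite bform_tr bformDl -!(bform_tr M). Qed.

Lemma bformNr M y z : bform M y (- z) = - bform M y z.
Proof. by rewrite bform_tr bformNl -!(bform_tr M). Qed.

Lemma bformZr M c y z : bform M y (c *: z) = c * bform M y z.
Proof. by rewrite bform_tr bformZl -!(bform_tr M). Qed.

Lemma bform_mull M A y z : bform M (y *m A) z = bform (A *m M) y z.
Proof. by rewrite /bform !mulmxA. Qed.

Lemma bform_mulr M A y z : bform M y (z *m A) = bform (M *m A^T) y z.
Proof. by rewrite /bform trmx_mul !mulmxA. Qed.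

Lemma bformDmx M A y z : bform (M + A) y z = bform M y z + bform A y z.
Proof. by rewrite /bform mulmxDr mulmxDl mxE. Qed.

Lemma bformNmx M y z : bform (- M) y z = - bform M y z.
Proof. by rewrite /bform mulmxN mulNmx mxE. Qed.

Lemma bformZmx c M y z : bform (c *: M) y z = c * bform M y z.
Proof. by rewrite /bform -scalemxAr -scalemxAl mxE. Qed.

Lemma bform_diag M u : is_diag_mx M -> bform M u u = \sum_i M i i * u 0 i ^+ 2.
Proof.
move=> /is_diag_mxP dM; rewrite bformE; apply: eq_bigr => i _.
rewrite (bigD1 i)//= big1 ?addr0; last first.
  by move=> j ji; rewrite dM ?mulr0 ?mul0r// eq_sym.
by rewrite mulrAC mulrC expr2.
Qed.

Lemma bform1_ge0 u : 0 <= bform 1%:M u u.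
Proof.
rewrite bform_diag ?scalar_mx_is_diag//; apply: sumr_ge0 => i _.
by rewrite mxE eqxx mulr1n mul1r sqr_ge0.
Qed.

Lemma bform_delta M i j : bform M (delta_mx 0 i) (delta_mx 0 j) = M i j.
Proof. by rewrite /bform -rowE trmx_delta -colE !mxE. Qed.

Lemma posdefmx_unit M : posdefmx M -> M \in unitmx.
Proof.
move=> [_ pM]; rewrite -row_free_unit; apply: inj_row_free => u uM.
by apply/eqP; apply: contraT => /pM; rewrite uM mul0mx mxE ltxx.
Qed.

Lemma posdefmx_invmx M : posdefmx M -> posdefmx (invmx M).
Proof.
move=> pM; have uM := posdefmx_unit pM; have [sM qM] := pM.
split; first by rewrite trmx_inv sM.
move=> u u0; set w := u *m invmx M.
have uE : u = w *m M by rewrite /w mulmxKV.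
have w0 : w != 0 by apply: contraNneq u0 => w0; rewrite uE w0 mul0mx.
by rewrite {1}uE trmx_mul sM mulmxA; exact: qM.
Qed.

Lemma bform_ge0 M u : possemidefmx M -> 0 <= bform M u u.
Proof. by move=> [_ /(_ u)]. Qed.

Lemma posdefmx_semi M : posdefmx M -> possemidefmx M.
Proof.
move=> [sM pM]; split=> // u; have [->|/pM/ltW//] := eqVneq u 0.
by rewrite mul0mx mul0mx mxE.
Qed.

Lemma bform_abs_le M u : bform M u u <= (\sum_i \sum_j `|M i j|) * bform 1%:M u u.
Proof.
have E : bform 1%:M u u = \sum_i u 0 i ^+ 2.
  rewrite bform_diag ?scalar_mx_is_diag//; apply: eq_bigr => i _.
  by rewrite mxE eqxx mulr1n mul1r.
have le i : u 0 i ^+ 2 <= bform 1%:M u u.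
  by rewrite E (bigD1 i)//= lerDl; apply: sumr_ge0 => j _; exact: sqr_ge0.
rewrite bformE mulr_suml; apply: ler_sum => i _; rewrite mulr_suml.
apply: ler_sum => j _; rewrite mulrAC mulrC.
apply: (le_trans (ler_norm _)); rewrite normrM ler_wpM2l// ler_norml.
have := le i; have := le j; move: (bform _ _ _) (u 0 i) (u 0 j) => B a b h1 h2.
by apply/andP; split; nra.
Qed.

(* For v = u M^-1, the form M is nonnegative at u - s v; the term linear in s is
   -2 s |u|^2 and the quadratic one is at most s^2 C |u|^2. Take s = 1/C. *)
Lemma posdefmx_coercive M : posdefmx M ->
  exists2 c, 0 < c & forall u, c * bform 1%:M u u <= bform M u u.
Proof.
move=> pM; have uM := posdefmx_unit pM; have [sM _] := pM.
pose C := 1 + \sum_i \sum_j `|invmx M i j|.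
have S0 : 0 <= \sum_i \sum_j `|invmx M i j|.
  by apply: sumr_ge0 => i _; exact: sumr_ge0.
have C0 : 0 < C by rewrite /C; lra.
exists C^-1; first by rewrite invr_gt0.
move=> u; have := bform_abs_le (invmx M) u.
have := bform_ge0 (u - C^-1 *: (u *m invmx M)) (posdefmx_semi pM).
rewrite bformDl !bformDr !bformNl !bformNr !bformZl !bformZr.
rewrite !bform_mull !bform_mulr trmx_inv sM mulVmx// mul1mx mulmxV//.
have := bform1_ge0 u; rewrite -/(bform _ _ _).
move: (bform 1%:M u u) (bform (invmx M) u u) (bform M u u) => a k q a0 h1 h2.
have hk : k <= C * a by rewrite /C; nra.
have e : C * C^-1 = 1 by rewrite divff// gt_eqF.
have iC : 0 < C^-1 by rewrite invr_gt0.
have : C^-1 * (C^-1 * k) <= C^-1 * a.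
  by rewrite ler_pM2l// -(ler_pM2l C0) mulrA e mul1r.
lra.
Qed.

End bilinear_forms.

(** * Moments of a Gaussian law *)

Section gaussian_moments.
Context {R : realType} {n : nat}.

Definition row_of_tuple (t : n.-tuple R) : 'rV[R]_n := \row_i tnth t i.

Lemma row_of_shift_tuple (a : 'rV[R]_n) (t : n.-tuple R) :
  row_of_tuple (shift_tuple a t) = row_of_tuple t + a.
Proof. by apply/rowP => i; rewrite !mxE tnth_mktuple. Qed.

Lemma measurable_bform d (T : measurableType d) (M : 'M[R]_n)
    (y z : T -> 'rV[R]_n) :
  (forall i, measurable_fun setT (fun w => y w 0 i)) ->
  (forall i, measurable_fun setT (fun w => z w 0 i)) ->
  measurable_fun setT (fun w => bform M (y w) (z w)).
Proof.
move=> my mz; under eq_fun do rewrite bformE.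
apply: measurable_sum => i; apply: measurable_sum => j.
by apply: measurable_funM => //; exact: measurable_funM.
Qed.

Lemma measurable_row_of_tuple (mu : 'rV[R]_n) i :
  measurable_fun setT (fun t : n.-tuple R => (row_of_tuple t - mu) 0 i).
Proof.
under eq_fun do rewrite !mxE.
by apply: measurable_funB => //; exact: measurable_tnth.
Qed.

Variables (Q : probability (n.-tuple R) R) (mu : 'rV[R]_n) (K M : 'M[R]_n) (c : R).
Hypotheses (sK : K^T = K) (KM : K *m M = 1%:M) (c0 : 0 <= c).

Let g (t : n.-tuple R) := c * expR (- bform M (row_of_tuple t - mu) (row_of_tuple t - mu) / 2).

Hypothesis Qg : forall A, measurable A ->
  (Q A = \int[lebesgue_tuple n]_(t in A) (g t)%:E)%E.

Let mg : measurable_fun setT g.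
Proof.
apply: measurable_funM => //; apply: measurableT_comp => //.
apply: measurable_funM => //; apply: measurableT_comp => //.
by apply: measurable_bform; exact: measurable_row_of_tuple.
Qed.

Let g0 t : 0 <= g t. Proof. by rewrite mulr_ge0// expR_ge0. Qed.

Let MK : M *m K = 1%:M. Proof. exact: mulmx1C. Qed.

(** Completing the square turns the exponential tilt into a translation of the density by s v K.
    Translation invariance and the total mass 1 of [Q] then give the value, whatever the constant
    [c] is. *)
Lemma gaussian_mgf (v : 'rV[R]_n) s :
  (\int[Q]_t (expR (s * bform 1%:M v (row_of_tuple t - mu)))%:E =
   (expR (s ^+ 2 * bform K v v / 2))%:E)%E.
Proof.
have mexp : measurable_fun setT
    (fun t : n.-tuple R => expR (s * bform 1%:M v (row_of_tuple t - mu))).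
  apply: measurableT_comp => //; apply: measurable_funM => //.
  by apply: measurable_bform => // i; exact: measurable_row_of_tuple.
rewrite (ge0_integral_density (mu := lebesgue_tuple n) mg g0)//; last first.
  exact/measurable_EFinP.
have E t : ((g t)%:E * (expR (s * bform 1%:M v (row_of_tuple t - mu)))%:E =
    (expR (s ^+ 2 * bform K v v / 2))%:E * (g (shift_tuple (- (s *: (v *m K))) t))%:E)%E.
  rewrite -!EFinM; congr EFin; rewrite /g -[LHS]mulrA -expRD [RHS]mulrCA -expRD.
  congr (_ * expR _).
  rewrite row_of_shift_tuple addrAC.
  move: (row_of_tuple t - mu) => y.
  rewrite bformDl !bformDr !bformNl !bformNr !bformZl !bformZr.
  rewrite !bform_mull !bform_mulr sK MK KM mul1mx.
  by rewrite (bformC y v) ?trmx1//; lra.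
under eq_integral do rewrite E.
rewrite ge0_integralZl ?lee_fin ?expR_ge0//; last 2 first.
- by apply/measurable_EFinP/measurableT_comp => //; exact: measurable_shift_tuple.
- by move=> t _; rewrite lee_fin.
rewrite (lebesgue_tuple_translation _ (f := fun t => (g t)%:E))//; last first.
  exact/measurable_EFinP.
by rewrite -Qg// probability_setT mule1.
Qed.

Let Y i (t : n.-tuple R) := tnth t i - mu 0 i.

Let mbf v : measurable_fun setT (fun t => bform 1%:M v (row_of_tuple t - mu)).
Proof. by apply: measurable_bform => // i; exact: measurable_row_of_tuple. Qed.

Let bfY i t : bform 1%:M (delta_mx 0 i) (row_of_tuple t - mu) = Y i t.
Proof.
by rewrite /bform mulmx1 -rowE !mxE.
Qed.

Lemma gaussian_integrable i : Q.-integrable setT (EFin \o Y i).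
Proof.
have := mgf_integrable (mbf _) (gaussian_mgf (delta_mx 0 i)).
by under eq_fun do rewrite bfY.
Qed.

Lemma gaussian_mean i : \int[Q]_t Y i t = 0.
Proof.
rewrite -(mgf_mean (mbf _) (gaussian_mgf (delta_mx 0 i))).
by apply: eq_Rintegral => t _; rewrite bfY.
Qed.

(** Polarisation: products of coordinates reduce to squares of linear forms, whose moments come from
    the generating function. *)
Let YY i j t : Y i t * Y j t = 2^-1 *
  (bform 1%:M (delta_mx 0 i + delta_mx 0 j) (row_of_tuple t - mu) ^+ 2
   - (bform 1%:M (delta_mx 0 i) (row_of_tuple t - mu) ^+ 2
   + bform 1%:M (delta_mx 0 j) (row_of_tuple t - mu) ^+ 2)).
Proof. by rewrite bformDl !bfY; field. Qed.

Let isq v := mgf_integrable_sqr (mbf v) (gaussian_mgf v).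

Lemma gaussian_integrable2 i j : Q.-integrable setT (EFin \o (fun t => Y i t * Y j t)).
Proof.
under eq_fun do rewrite YY.
apply: integrable_scaleR; apply: integrable_subR; first exact: isq.
by apply: integrable_addR; exact: isq.
Qed.

Lemma gaussian_covariance i j : \int[Q]_t (Y i t * Y j t) = K i j.
Proof.
under eq_Rintegral do rewrite YY.
rewrite RintegralZl//; last first.
  by apply: integrable_subR; [|apply: integrable_addR]; exact: isq.
rewrite RintegralB//; last by apply: integrable_addR; exact: isq.
rewrite RintegralD//.
rewrite !(mgf_variance (mbf _) (gaussian_mgf _)).
rewrite bformDl !bformDr !bform_delta.
have -> : K j i = K i j by rewrite -[in LHS]sK mxE.
by field.
Qed.

End gaussian_moments.

(** * Conditional expectation *)

Section conditional_expectation.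
Local Open Scope ereal_scope.
Context {R : realType} {d d' : measure_display} {Omega : measurableType d}
  {T : measurableType d'} (P : probability Omega R) (U : {RV P >-> T}).
Implicit Types (phi : Omega -> R) (gamma h : T -> R).

(* gamma(U) is a version of E[phi | U], for phi >= 0. *)
Definition is_cond_exp phi gamma : Prop :=
  [/\ measurable_fun setT gamma, (forall t, 0 <= gamma t)%R &
    forall h, measurable_fun setT h -> (forall t, 0 <= h t)%R ->
      \int[P]_w (phi w * h (U w))%:E = \int[P]_w (gamma (U w) * h (U w))%:E].

Let mU : measurable_fun setT U. Proof. exact: measurable_funPT. Qed.

Lemma is_cond_expP phi gamma :
  measurable_fun setT phi -> (forall w, 0 <= phi w)%R ->
  measurable_fun setT gamma -> (forall t, 0 <= gamma t)%R ->
  (forall B, measurable B -> \int[P]_(w in U @^-1` B) (phi w)%:E =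
                             \int[P]_(w in U @^-1` B) (gamma (U w))%:E) ->
  is_cond_exp phi gamma.
Proof.
move=> mphi phi0 mg g0 E; split=> // h mh h0.
under eq_integral do rewrite EFinM.
under [RHS]eq_integral do rewrite EFinM.
apply: (@ge0_integral_ext _ _ _ _ _ _ _ P P U U phi (gamma \o U) _ _ _ _ _ _ _ (EFin \o h)) => //.
- exact: measurableT_comp.
- by move=> w; exact: g0.
- exact/measurable_EFinP.
Qed.

(** Under the probability with density phi / E[phi], the law of U is dominated by its law under P;
    [gamma] is E[phi] times the Radon-Nikodym derivative. The normalisation forces the case E[phi] =
    0 to be split off. *)
Lemma cond_exp_exists phi : measurable_fun setT phi -> (forall w, 0 <= phi w)%R ->
  \int[P]_w (phi w)%:E < +oo -> exists gamma, is_cond_exp phi gamma.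
Proof.
move=> mphi phi0 phioo.
have I0 : 0 <= \int[P]_w (phi w)%:E.
  by apply: integral_ge0 => w _; rewrite lee_fin.
have [Iz|Inz] := eqVneq (\int[P]_w (phi w)%:E) 0.
  exists (cst 0%R); apply: is_cond_expP => // B mB.
  have mUB : measurable (U @^-1` B) by rewrite -[X in measurable X]setTI; exact: mU.
  rewrite [RHS]integral0; apply/eqP; rewrite eq_le; apply/andP; split; last first.
    by apply: integral_ge0 => w _; rewrite lee_fin.
  rewrite -Iz; apply: ge0_subset_integral => //; first exact/measurable_EFinP.
  by move=> w _; rewrite lee_fin.
pose c := fine (\int[P]_w (phi w)%:E).
have cE : c%:E = \int[P]_w (phi w)%:E by rewrite fineK// ge0_fin_numE.
have c0 : (0 < c)%R by rewrite -lte_fin cE lt0e Inz I0.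
have mf : measurable_fun setT (fun w => c^-1 * phi w)%R by exact: measurable_funM.
have f0 w : (0 <= c^-1 * phi w)%R by rewrite mulr_ge0// invr_ge0 ltW.
have intf B : measurable B ->
    \int[P]_(w in B) (c^-1 * phi w)%:E = c^-1%:E * \int[P]_(w in B) (phi w)%:E.
  move=> mB; under eq_integral do rewrite EFinM.
  rewrite ge0_integralZl ?lee_fin ?invr_ge0 ?(ltW c0)//.
    by apply/measurable_EFinP/measurable_funTS.
  by move=> w _; rewrite lee_fin.
have f1 : \int[P]_w (c^-1 * phi w)%:E = 1.
  by rewrite intf// -cE -EFinM mulVf// gt_eqF.
pose Q := density_probability mf f0 f1.
pose V : {RV Q >-> T} := U.
pose D := distribution Q V; pose PU := distribution P U.
have DE B : measurable B -> D B = c^-1%:E * \int[P]_(w in U @^-1` B) (phi w)%:E.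
  move=> mB; rewrite -intf//.
  by rewrite -[X in measurable X]setTI; exact: mU.
have dom : D `<< PU.
  apply/null_content_dominatesP => A mA PA0.
  have mUA : measurable (U @^-1` A) by rewrite -[X in measurable X]setTI; exact: mU.
  rewrite DE// null_set_integral ?mule0//.
  by apply/measurable_EFinP/measurable_funTS.
pose g := Radon_Nikodym_SigmaFinite.f D PU.
have g0 t : 0 <= g t by exact: Radon_Nikodym_SigmaFinite.f_ge0.
have gfin t : g t \is a fin_num by exact: Radon_Nikodym_SigmaFinite.f_fin_num.
have mg : measurable_fun setT g.
  exact: measurable_int (Radon_Nikodym_SigmaFinite.f_integrable dom).
have mgam : measurable_fun setT (fun t => c * fine (g t))%R.
  by apply: measurable_funM => //; exact: measurableT_comp.
have gam0 t : (0 <= c * fine (g t))%R.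
  by rewrite mulr_ge0 ?(ltW c0)// fine_ge0.
exists (fun t => c * fine (g t))%R; apply: is_cond_expP => // B mB.
have mUB : measurable (U @^-1` B) by rewrite -[X in measurable X]setTI; exact: mU.
transitivity (c%:E * D B).
  by rewrite DE// muleA -EFinM divff ?gt_eqF// mul1e.
have -> : D B = \int[PU]_(t in B) g t by exact: Radon_Nikodym_SigmaFinite.f_integral.
rewrite [X in _ * X](@ge0_integral_pushforward _ _ _ _ _ _ mU P B g)//; last first.
  exact: measurable_funTS.
rewrite -ge0_integralZl ?lee_fin ?(ltW c0)//.
- by apply: eq_integral => w _ /=; rewrite EFinM (fineK (gfin _)).
- by apply: measurable_funTS; exact: measurableT_comp.
- by move=> w _; exact: g0.
Qed.

(** Conditional Jensen for the square. With h = min(gamma, n), E[h^2] <= E[gamma h] = E[phi h] <=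
    (E[phi^2] + E[h^2]) / 2; truncation makes E[h^2] finite, so that it can be subtracted, and n
    tends to infinity by monotone convergence. *)
Lemma cond_exp_sqr phi gamma : measurable_fun setT phi -> (forall w, 0 <= phi w)%R ->
  is_cond_exp phi gamma -> \int[P]_w (phi w ^+ 2)%:E < +oo ->
  \int[P]_w (gamma (U w) ^+ 2)%:E <= \int[P]_w (phi w ^+ 2)%:E.
Proof.
move=> mphi phi0 [mg g0 E] phi2.
pose h n t := Num.min (gamma t) n%:R.
have mh n : measurable_fun setT (h n) by exact: measurable_minr.
have h0 n t : (0 <= h n t)%R by rewrite le_min g0 ler0n.
have mhU n : measurable_fun setT (fun w => h n (U w)) by exact: measurableT_comp.
have mgU : measurable_fun setT (fun w => gamma (U w)) by exact: measurableT_comp.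
have hle n : \int[P]_w (h n (U w) ^+ 2)%:E <= \int[P]_w (phi w ^+ 2)%:E.
  have fin : \int[P]_w (h n (U w) ^+ 2)%:E \is a fin_num.
    rewrite ge0_fin_numE; last by apply: integral_ge0 => w _; rewrite lee_fin sqr_ge0.
    apply: (@le_lt_trans _ _ (\int[P]_w (n%:R ^+ 2)%:E)).
      apply: ge0_le_integral => //.
      - by move=> w _; rewrite lee_fin sqr_ge0.
      - by apply/measurable_EFinP/measurable_funX.
      - move=> w _; rewrite lee_fin lerXn2r ?nnegrE//.
        by rewrite ge_min lexx orbT.
    by rewrite integral_probability_cst ltry.
  have le1 : \int[P]_w (h n (U w) ^+ 2)%:E <= \int[P]_w (phi w * h n (U w))%:E.
    rewrite E//; apply: ge0_le_integral => //.
    - by move=> w _; rewrite lee_fin sqr_ge0.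
    - by apply/measurable_EFinP/measurable_funX.
    - by apply/measurable_EFinP/measurable_funM.
    - by move=> w _; rewrite lee_fin expr2 ler_wpM2r// ge_min lexx.
  have le2 : \int[P]_w (phi w * h n (U w))%:E <=
      2^-1%:E * (\int[P]_w (phi w ^+ 2)%:E + \int[P]_w (h n (U w) ^+ 2)%:E).
    rewrite -ge0_integralD//; last 4 first.
    - by move=> w _; rewrite lee_fin sqr_ge0.
    - by apply/measurable_EFinP/measurable_funX.
    - by move=> w _; rewrite lee_fin sqr_ge0.
    - by apply/measurable_EFinP/measurable_funX.
    rewrite -ge0_integralZl ?lee_fin//; last 2 first.
    - by apply/measurable_EFinP/measurable_funD; exact: measurable_funX.
    - by move=> w _; rewrite lee_fin addr_ge0// sqr_ge0.
    apply: ge0_le_integral => //.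
    - by move=> w _; rewrite lee_fin mulr_ge0.
    - by apply/measurable_EFinP/measurable_funM.
    - by apply/measurable_EFinP/measurable_funM => //; apply: measurable_funD; exact: measurable_funX.
    - by move=> w _; rewrite lee_fin; have := sqr_ge0 (phi w - h n (U w)); lra.
  have phifin : \int[P]_w (phi w ^+ 2)%:E \is a fin_num.
    by rewrite ge0_fin_numE//; apply: integral_ge0 => w _; rewrite lee_fin sqr_ge0.
  have := le_trans le1 le2; rewrite -(fineK fin) -(fineK phifin) -EFinD -EFinM !lee_fin.
  lra.
have -> : \int[P]_w (gamma (U w) ^+ 2)%:E =
    limn (fun n => \int[P]_w (h n (U w) ^+ 2)%:E).
  rewrite -monotone_convergence//.
  - apply: eq_integral => w _; apply/esym/cvg_lim => //; apply: cvg_near_cst.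
    near=> n; congr (_ ^+ 2)%:E; apply/min_idPl.
    by near: n; exact: nbhs_infty_ger.
  - by move=> n; apply/measurable_EFinP/measurable_funX.
  - by move=> n w _; rewrite lee_fin sqr_ge0.
  - move=> w _ a b ab; rewrite lee_fin lerXn2r ?nnegrE// le_min ge_min lexx/=.
    by rewrite ge_min ler_nat ab orbT.
apply: lime_le; last by apply: nearW.
apply: ereal_nondecreasing_is_cvgn => a b ab; apply: ge0_le_integral => //.
- by move=> w _; rewrite lee_fin sqr_ge0.
- by apply/measurable_EFinP/measurable_funX.
- by apply/measurable_EFinP/measurable_funX.
- move=> w _; rewrite lee_fin lerXn2r ?nnegrE// le_min ge_min lexx/=.
  by rewrite ge_min ler_nat ab orbT.
Unshelve. all: by end_near. Qed.

End conditional_expectation.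

(** * Conditional independence given U *)

Section conditional_independence.
Local Open Scope ereal_scope.
Context {R : realType} {d d' : measure_display} {Omega : measurableType d}
  {T : measurableType d'} (P : probability Omega R) (U : {RV P >-> T}).

Let mU : measurable_fun setT U. Proof. exact: measurable_funPT. Qed.

Let mUpre B : measurable B -> measurable (U @^-1` B).
Proof. by move=> mB; rewrite -[X in measurable X]setTI; exact: mU. Qed.

Lemma cond_exp_indic_exists E : measurable E ->
  exists gamma, is_cond_exp U (\1_E : Omega -> R) gamma.
Proof.
move=> mE; apply: cond_exp_exists => //.
rewrite integral_indic// setIT; apply: (le_lt_trans (probability_le1 P mE)).
exact: ltry.
Qed.

(** A version in the sense of [is_cond_prob] may be negative on a null set, whereas [is_cond_exp]
    asks for nonnegativity everywhere. Almost sure equality lets the versions supplied by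
    conditional independence be replaced by nonnegative ones. *)
Lemma cond_prob_unique E g gamma : measurable E ->
  is_cond_prob U E g -> is_cond_exp U (\1_E : Omega -> R) gamma ->
  ae_eq (distribution P U) setT (EFin \o gamma) (EFin \o g).
Proof.
move=> mE [mg gE] [mgam gam0 gamE].
have intgam B : measurable B ->
    \int[distribution P U]_(t in B) (gamma t)%:E = P (E `&` U @^-1` B).
  move=> mB; rewrite integral_mkcond ge0_integral_distribution; last 2 first.
  - by apply/(measurable_restrictT _ _).1 => //; apply/measurable_funTS/measurable_EFinP.
  - by move=> t; rewrite patchE; case: ifP => //; rewrite lee_fin.
  have := gamE (\1_B) (measurable_indic mB) (fun t => ler0n _ _).
  rewrite (_ : \int[P]_w (\1_E w * \1_B (U w))%:E = P (E `&` U @^-1` B)).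
    move=> ->; apply: eq_integral => w _ /=; rewrite patchE indicE.
    by case: ifP => _; rewrite ?mulr1 ?mulr0.
  rewrite -[RHS]integral_indic//; last exact: mUpre.
  rewrite [RHS]integral_mkcond; apply: eq_integral => w _.
  have -> : \1_B (U w) = \1_(U @^-1` B) w :> R by rewrite !indicE; congr ((_ : bool)%:R); apply/idP/idP; rewrite !inE.
  by rewrite patchE [X in (_ * X)%R]indicE; case: ifP => _; rewrite ?mulr1 ?mulr0.
apply: integral_ae_eq => //.
- apply/integrableP; split; first exact/measurable_EFinP.
  under eq_integral do rewrite /= ger0_norm//.
  rewrite intgam//; apply: (le_lt_trans (probability_le1 _ _)).
    by apply: measurableI => //; exact: mUpre.
  exact: ltry.
- exact/measurable_EFinP.
- by move=> B _ mB; rewrite intgam// gE.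
Qed.

Context {m : nat} (Y : 'I_m -> {RV P >-> R}).
Hypothesis ciY : mutually_cond_independent U Y.

Let mYpre i B : measurable B -> measurable (Y i @^-1` B).
Proof. by move=> mB; exact: measurable_funPTI. Qed.

Lemma cond_independent_pair i j A B gA gB : i != j -> measurable A -> measurable B ->
  is_cond_exp U (\1_(Y i @^-1` A) : Omega -> R) gA ->
  is_cond_exp U (\1_(Y j @^-1` B) : Omega -> R) gB ->
  P (Y i @^-1` A `&` Y j @^-1` B) = \int[P]_w (gA (U w) * gB (U w))%:E.
Proof.
move=> ij mA mB ceA ceB.
(* The coordinates other than i and j are left unconstrained; the constant 1 is then a version of
   their conditional probability. *)
pose C k : set R := if k == i then A else if k == j then B else setT.
have mC k : measurable (C k) by rewrite /C; case: ifP => // _; case: ifP.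
have [g [gC gall]] := ciY mC.
pose G k : T -> R := if k == i then gA else if k == j then gB else cst 1%R.
have ceG k : is_cond_exp U (\1_(Y k @^-1` C k) : Omega -> R) (G k).
  rewrite /G /C; case: eqVneq => [->//|ki]; case: eqVneq => [->//|kj].
  by split=> // h mh h0; rewrite preimage_setT indicT.
have aeG k := cond_prob_unique (mYpre k (mC k)) (gC k) (ceG k).
have aeall : {ae distribution P U, forall t, forall k, G k t = g k t}.
  apply: filter_forall => k; apply: filterS (aeG k) => t /= /(_ Logic.I).
  by case.
have [mprod /(_ setT measurableT)] := gall.
rewrite preimage_setT setIT.
have -> : [set w | forall k, C k (Y k w)] = Y i @^-1` A `&` Y j @^-1` B.
  apply/seteqP; split=> w /=.
    move=> H; have := H i; have := H j; rewrite /C eqxx eqxx.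
    by rewrite eq_sym (negPf ij).
  move=> [wA wB] k; rewrite /C; case: eqVneq => [->//|_].
  by case: eqVneq => [->//|_].
move=> ->.
have [mgA gA0 _] := ceA; have [mgB gB0 _] := ceB.
rewrite (@ae_eq_integral _ _ _ _ setT (fun t => (gA t * gB t)%:E))//.
- rewrite ge0_integral_distribution//.
    by apply/measurable_EFinP/measurable_funM.
  by move=> t; rewrite lee_fin mulr_ge0.
- exact/measurable_EFinP.
- by apply/measurable_EFinP/measurable_funM.
apply: filterS aeall => t H _; congr EFin.
under eq_bigr do rewrite -H.
rewrite (bigD1 i)//= (bigD1 j) ?(eq_sym j)//= big1 ?mulr1.
  by rewrite /G eqxx eq_sym (negPf ij) eqxx.
by move=> k /andP[ki kj]; rewrite /G (negPf ki) (negPf kj).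
Qed.

(** The form in which the lower bound uses conditional independence: in a product, [psi (Y j)] may
    be replaced by its conditional expectation. Indicators are extended one argument at a time,
    first in [psi] with the event on [Y i] fixed, then in [phi]. *)
Lemma cond_independent_cross i j (phi psi : R -> R) gamma : i != j ->
  measurable_fun setT phi -> (forall x, 0 <= phi x)%R ->
  measurable_fun setT psi -> (forall x, 0 <= psi x)%R ->
  is_cond_exp U (psi \o Y j) gamma ->
  \int[P]_w (phi (Y i w) * psi (Y j w))%:E = \int[P]_w (phi (Y i w) * gamma (U w))%:E.
Proof.
move=> ij mphi phi0 mpsi psi0 ceg.
have [mg g0 gE] := ceg.
have step2 A : measurable A ->
    \int[P]_w (\1_(Y i @^-1` A) w * psi (Y j w))%:E =
    \int[P]_w (\1_(Y i @^-1` A) w * gamma (U w))%:E.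
  move=> mA; have [gA ceA] := cond_exp_indic_exists (mYpre i mA).
  have [mgA gA0 gAE] := ceA.
  rewrite gAE//.
  transitivity (\int[P]_w (gA (U w) * psi (Y j w))%:E); last first.
    under eq_integral do rewrite mulrC.
    under [RHS]eq_integral do rewrite mulrC.
    exact: gE.
  under eq_integral do rewrite EFinM.
  under [RHS]eq_integral do rewrite EFinM.
  apply: (@ge0_integral_ext _ _ _ _ _ _ _ P P (Y j) (Y j) _ (gA \o U) _ _ _ _ _ _ _ (EFin \o psi)) => //.
  - exact: measurable_indic (mYpre i mA).
  - exact: measurableT_comp.
  - by move=> w; exact: gA0.
  - move=> B mB; have [gB ceB] := cond_exp_indic_exists (mYpre j mB).
    have [mgB gB0 gBE] := ceB.
    transitivity (P (Y i @^-1` A `&` Y j @^-1` B)).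
      by rewrite integral_indic//; exact: mYpre.
    rewrite (cond_independent_pair ij mA mB ceA ceB).
    transitivity (\int[P]_w (gB (U w) * gA (U w))%:E).
      by apply: eq_integral => w _; rewrite mulrC.
    rewrite -(gBE gA mgA gA0) [RHS]integral_mkcond; apply: eq_integral => w _.
    by rewrite patchE indicE; case: ifP => _; rewrite ?mul1r ?mul0r.
  - exact/measurable_EFinP.
under eq_integral do rewrite mulrC EFinM.
under [RHS]eq_integral do rewrite mulrC EFinM.
apply: (@ge0_integral_ext _ _ _ _ _ _ _ P P (Y i) (Y i) (psi \o Y j) (gamma \o U) _ _ _ _ _ _ _ (EFin \o phi)) => //.
- exact: measurableT_comp.
- exact: measurableT_comp.
- by move=> w; exact: psi0.
- by move=> w; exact: g0.
- move=> A mA; rewrite integral_mkcond [RHS]integral_mkcond.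
  have := step2 A mA.
  have E (f : Omega -> R) w : ((fun x => (f x)%:E) \_ (Y i @^-1` A)) w =
      (\1_(Y i @^-1` A) w * f w)%:E.
    by rewrite patchE indicE; case: ifP => _; rewrite ?mul1r ?mul0r.
  under [in X in _ -> X]eq_integral do rewrite (E (psi \o Y j)).
  under [in X in _ -> _ = X]eq_integral do rewrite (E (gamma \o U)).
  by [].
- exact/measurable_EFinP.
Qed.

End conditional_independence.

(** * Relative entropy *)

Section kullback_leibler.
Local Open Scope ereal_scope.
Local Open Scope charge_scope.
Context {R : realType} {d : measure_display} {T : measurableType d}.
Implicit Types (mu nu : probability T R) (f r : T -> R) (b : R).

(** The larger function need not be integrable, since a relative entropy may be infinite; hence the
    comparison through positive and negative parts. *)
Lemma le_integral_integrable mu (g F : T -> \bar R) :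
  mu.-integrable setT g -> measurable_fun setT F -> (forall x, g x <= F x) ->
  \int[mu]_x g x <= \int[mu]_x F x.
Proof.
move=> ig mF gF; rewrite integralE [leRHS]integralE; apply: leeB.
  apply: ge0_le_integral => //.
  - by apply: measurable_funepos; exact: measurable_int ig.
  - exact: measurable_funepos.
  - by move=> x _; apply: (@funepos_le _ _ setT); rewrite ?inE.
apply: ge0_le_integral => //.
- exact: measurable_funeneg.
- by apply: measurable_funeneg; exact: measurable_int ig.
- by move=> x _; apply: (@funeneg_le _ _ setT); rewrite ?inE.
Qed.

Lemma measurable_logb b f : measurable_fun setT f ->
  measurable_fun setT (fun x => logb b (f x)).
Proof.
move=> mf; apply: measurable_funM => //.
by apply: measurableT_comp => //; exact: measurable_ln.
Qed.

Lemma density_dominates mu nu r : measurable_fun setT r ->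
  (forall A, measurable A -> mu A = \int[nu]_(x in A) (r x)%:E) -> mu `<< nu.
Proof.
move=> mr E; apply/null_content_dominatesP => A mA nuA0.
by rewrite E// null_set_integral//; apply/measurable_EFinP/measurable_funTS.
Qed.

Lemma dominates_density mu nu : mu `<< nu ->
  exists r, [/\ measurable_fun setT r, (forall x, 0 <= r x)%R &
    forall A, measurable A -> mu A = \int[nu]_(x in A) (r x)%:E].
Proof.
move=> dom; pose g := Radon_Nikodym_SigmaFinite.f mu nu.
have g0 t : 0 <= g t by exact: Radon_Nikodym_SigmaFinite.f_ge0.
have gfin t : g t \is a fin_num by exact: Radon_Nikodym_SigmaFinite.f_fin_num.
have mg : measurable_fun setT g.
  exact: measurable_int (Radon_Nikodym_SigmaFinite.f_integrable dom).
exists (fine \o g); split; first exact: measurableT_comp.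
  by move=> x; rewrite /= fine_ge0.
move=> A mA; under eq_integral do rewrite /= fineK//.
exact: Radon_Nikodym_SigmaFinite.f_integral.
Qed.

(** Two densities agree nu-almost everywhere, hence mu-almost everywhere by domination, and the
    logarithm is integrated against mu. *)
Lemma kl_divergence_density b mu nu r : measurable_fun setT r ->
  (forall x, 0 <= r x)%R ->
  (forall A, measurable A -> mu A = \int[nu]_(x in A) (r x)%:E) ->
  kl_divergence b mu nu = \int[mu]_x (logb b (r x))%:E.
Proof.
move=> mr r0 E; have dom := density_dominates mr E.
rewrite /kl_divergence asboolT//.
set h := 'd (charge_of_finite_measure mu) '/d nu.
have mh : measurable_fun setT h.
  by apply: measurable_int; exact: Radon_Nikodym_integrable.
have aeh : ae_eq nu setT (EFin \o r) h.
  apply: integral_ae_eq => //.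
  - apply/integrableP; split; first exact/measurable_EFinP.
    under eq_integral do rewrite /= ger0_norm//.
    rewrite -E//; apply: (le_lt_trans (probability_le1 _ measurableT)).
    exact: ltry.
  - by move=> A _ mA; rewrite -E// -Radon_Nikodym_integral.
have aemu : ae_eq mu setT (EFin \o r) h.
  case: aeh => N [mN N0 NE]; exists N; split=> //.
  by have /null_content_dominatesP := dom; apply.
apply: ae_eq_integral => //.
- by apply/measurable_EFinP/measurable_logb; exact: measurableT_comp.
- by apply/measurable_EFinP/measurable_logb.
- by apply: filterS aemu => x /(_ Logic.I) /= <-.
Qed.

(* Donsker-Varadhan: pointwise, ln r >= f + 1 - e^f / r, and the mu-integral
   of e^f / r is at most the nu-integral of e^f. *)
Lemma kl_divergence_ge b mu nu f : (1 < b)%R -> measurable_fun setT f ->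
  mu.-integrable setT (EFin \o f) -> \int[nu]_x (expR (f x))%:E <= 1 ->
  ((\int[mu]_x f x)%R / ln b)%:E <= kl_divergence b mu nu.
Proof.
move=> b1 mf fi nuf; have lnb : (0 < ln b)%R by rewrite ln_gt0.
case: (pselect (mu `<< nu)) => [dom|ndom]; last first.
  by rewrite /kl_divergence asboolF// leey.
have [r [mr r0 E]] := dominates_density dom.
rewrite (kl_divergence_density b mr r0 E).
pose k x := expR (f x - ln (r x))%R.
have mk : measurable_fun setT k.
  apply: measurableT_comp => //; apply: measurable_funB => //.
  by apply: measurableT_comp => //; exact: measurable_ln.
have k0 x : (0 <= k x)%R by exact: expR_ge0.
have intk : \int[mu]_x (k x)%:E <= 1.
  rewrite (ge0_integral_density (mu := nu) mr r0)//; last exact/measurable_EFinP.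
  apply: le_trans nuf; apply: ge0_le_integral => //.
  - by move=> x _; rewrite -EFinM lee_fin mulr_ge0.
  - by apply/measurable_EFinP; exact: measurable_funM.
  - by apply/measurable_EFinP; exact: measurableT_comp.
  - move=> x _; rewrite -EFinM lee_fin /k.
    (* Only where [r] is positive does [r * k] equal e^f; elsewhere it is 0, which is why the bound
       on the integral is an inequality. *)
    have [->|rn] := eqVneq (r x) 0%R; first by rewrite mul0r expR_ge0.
    by rewrite expRB lnK ?posrE ?lt0r ?rn ?r0// mulrC divfK.
have ki : mu.-integrable setT (EFin \o k).
  apply/integrableP; split; first exact/measurable_EFinP.
  under eq_integral do rewrite /= ger0_norm//.
  exact: le_lt_trans intk (ltry _).
have kR : (\int[mu]_x k x <= 1)%R.
  rewrite /Rintegral -lee_fin fineK//; exact: integrable_fin_num.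
pose g x := (f x + 1 - k x)%R.
have gi : mu.-integrable setT (EFin \o g).
  apply: integrable_subR => //; apply: integrable_addR => //.
  exact: integrable_cstR.
have gE : (\int[mu]_x f x <= \int[mu]_x g x)%R.
  rewrite RintegralB//; last by apply: integrable_addR => //; exact: integrable_cstR.
  rewrite RintegralD//; last exact: integrable_cstR.
  by rewrite Rintegral_probability_cst; lra.
have mg : measurable_fun setT g by apply/measurable_EFinP; exact: measurable_int gi.
pose G x := ((ln b)^-1 * g x)%R.
have Gi : mu.-integrable setT (EFin \o G) by exact: integrable_scaleR.
have mG : measurable_fun setT G by exact: measurable_funM.
pose A := [set x | r x = 0%R].
have mA : measurable A.
  rewrite (_ : A = r @^-1` [set 0%R])//.
  by rewrite -[X in measurable X]setTI; apply: mr.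
have muA : mu A = 0.
  by rewrite E//; apply: integral0_eq => x ->.
(* The convention [ln 0 = 0] may break the pointwise bound where [r] vanishes. That set is mu-null,
   so the integrand is replaced there by the lower bound [G]. *)
pose F x := if r x == 0%R then G x else logb b (r x).
have mF : measurable_fun setT F.
  apply: measurable_fun_ifT => //; last exact: measurable_logb.
  exact: measurable_fun_eqr.
rewrite (@ae_eq_integral _ _ _ _ setT (EFin \o F))//; last 3 first.
- exact/measurable_EFinP/measurable_logb.
- exact/measurable_EFinP.
- exists A; split=> // x /= H; apply: contrapT => rx; apply: H => _.
  by rewrite /F; case: eqP.
apply: (@le_trans _ _ (\int[mu]_x (G x)%:E)).
  rewrite -[leRHS]fineK; last exact: integrable_fin_num.
  rewrite lee_fin -/(Rintegral mu setT G) RintegralZl// mulrC ler_pM2l//.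
  by rewrite invr_gt0.
apply: le_integral_integrable => //; first exact/measurable_EFinP.
move=> x; rewrite lee_fin /F; case: eqP => [//|/eqP rn].
have rp : (0 < r x)%R by rewrite lt0r rn r0.
rewrite /logb /G mulrC ler_pM2r ?invr_gt0// /g.
have := expR_ge1Dx (f x - ln (r x)); rewrite /k; lra.
Qed.

End kullback_leibler.

(** * Gaussian densities *)

Section gaussian_density_theory.
Context {R : realType} {n : nat}.
Implicit Types (D K : 'M[R]_n) (a : 'rV[R]_n).

Lemma gaussian_densityE a K x : gaussian_density a K x =
  (Num.sqrt ((2 * pi) ^+ n * \det K))^-1 *
  expR (- bform (invmx K) (row_of_tuple x - a) (row_of_tuple x - a) / 2).
Proof. by []. Qed.

Lemma gaussian_density_ge0 a K x : 0 <= gaussian_density a K x.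
Proof. by rewrite mulr_ge0 ?expR_ge0// invr_ge0 sqrtr_ge0. Qed.

Lemma measurable_gaussian_density a K : measurable_fun setT (gaussian_density a K).
Proof.
apply: measurable_funM => //; apply: measurableT_comp => //.
apply: measurable_funM => //; apply: measurableT_comp => //.
by apply: measurable_bform; exact: measurable_row_of_tuple.
Qed.

Lemma twopiX_gt0 : 0 < (2 * pi : R) ^+ n.
Proof. by rewrite exprn_gt0// mulr_gt0// pi_gt0. Qed.

(** The exponent is the log-likelihood ratio of the two Gaussians. It is the test function of the
    lower bound and the information density of the upper bound. *)
Lemma gaussian_density_ratio a a' D K x : 0 < \det D -> 0 < \det K ->
  gaussian_density a D x = gaussian_density a' K x *
   expR (2^-1 * ln (\det K / \det D)
    - bform (invmx D) (row_of_tuple x - a) (row_of_tuple x - a) / 2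
    + bform (invmx K) (row_of_tuple x - a') (row_of_tuple x - a') / 2).
Proof.
move=> D0 K0; rewrite !gaussian_densityE.
set q := bform (invmx D) _ _; set q' := bform (invmx K) _ _.
set C := _ * ln _.
have C2 : expR C ^+ 2 * \det D = \det K.
  rewrite -expRM_natl /C mulrA divff// mul1r lnK ?posrE ?divr_gt0//.
  by rewrite divfK// gt_eqF.
have -> : Num.sqrt ((2 * pi) ^+ n * \det K) =
    expR C * Num.sqrt ((2 * pi) ^+ n * \det D).
  rewrite -C2 mulrCA sqrtrM ?sqr_ge0// sqrtr_sqr ger0_norm// expR_ge0.
rewrite invfM -expRN [expR (- C) * _]mulrC -!mulrA -!expRD; congr (_ * expR _).
by lra.
Qed.

Lemma diag_mx_coef D : is_diag_mx D -> D = diag_mx (\row_i D i i).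
Proof.
move=> /is_diag_mxP dD; apply/matrixP => i j; rewrite !mxE.
by case: eqVneq => [->//|ij]; rewrite mulr0n dD.
Qed.

Lemma det_diagE D : is_diag_mx D -> \det D = \prod_i D i i.
Proof.
move=> dD; rewrite [in LHS](diag_mx_coef dD) det_diag.
by apply: eq_bigr => i _; rewrite mxE.
Qed.

Lemma det_diag_gt0 D : is_diag_mx D -> (forall i, 0 < D i i) -> 0 < \det D.
Proof. by move=> dD D0; rewrite det_diagE// prodr_gt0. Qed.

Lemma invmx_diag D : is_diag_mx D -> (forall i, 0 < D i i) ->
  invmx D = diag_mx (\row_i (D i i)^-1).
Proof.
move=> dD D0; have uD : D \in unitmx.
  by rewrite unitmxE unitfE gt_eqF// det_diag_gt0.
apply: (can_inj (mulKmx uD)); rewrite mulmxV// {1}(diag_mx_coef dD).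
rewrite mulmx_diag; apply/matrixP => i j; rewrite !mxE.
by rewrite divff// gt_eqF.
Qed.

(** Reduces normalisation for a diagonal covariance to the one-dimensional normal density. *)
Lemma gaussian_density_diagE a D x : is_diag_mx D -> (forall i, 0 < D i i) ->
  gaussian_density a D x =
  \prod_i normal_pdf (a 0 i) (Num.sqrt (D i i)) (tnth x i).
Proof.
move=> dD D0.
have s0 i : Num.sqrt (D i i) != 0 by rewrite gt_eqF// sqrtr_gt0.
have s2 i : Num.sqrt (D i i) ^+ 2 = D i i by rewrite sqr_sqrtr// ltW.
under eq_bigr do rewrite normal_pdfE//.
rewrite gaussian_densityE big_split /= -expR_sum; congr (_ * expR _).
  rewrite /normal_peak prodfV det_diagE//; congr (_^-1).
  have -> : (2 * pi) ^+ n = \prod_(i < n) (2 * pi : R) by rewrite prodr_const card_ord.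
  rewrite -big_split /=.
  elim/big_rec2 : _ => [|i y z _ IH]; first by rewrite sqrtr1.
  rewrite sqrtrM; last by rewrite !mulr_ge0 ?pi_ge0// ltW.
  by rewrite IH s2; congr (Num.sqrt _ * _); rewrite -mulr_natl; ring.
rewrite invmx_diag// bform_diag ?diag_mx_is_diag// -sumrN mulr_suml.
apply: eq_bigr => i _; rewrite !mxE eqxx mulr1n s2 -[D i i *+ 2]mulr_natl invfM.
by ring.
Qed.

Lemma integral_gaussian_density_diag a D : is_diag_mx D -> (forall i, 0 < D i i) ->
  (\int[lebesgue_tuple n]_x (gaussian_density a D x)%:E = 1)%E.
Proof.
move=> dD D0; under eq_integral do rewrite gaussian_density_diagE//.
rewrite (lebesgue_tuple_prod
  (f := fun i => normal_pdf (a 0 i) (Num.sqrt (D i i))) (c := fun=> 1)) ?big1//.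
- by move=> i; exact: measurable_normal_pdf.
- by move=> i x; exact: normal_pdf_ge0.
- by move=> i; exact: integral_normal_pdf.
Qed.

End gaussian_density_theory.

(** * Second moments and expectations of quadratic forms *)

Section second_moments.
Context {R : realType} {d : measure_display} {Omega : measurableType d}.
Variable P : probability Omega R.
Implicit Types f g : Omega -> R.

Definition square_integrable f : Prop :=
  measurable_fun setT f /\ P.-integrable setT (EFin \o (fun w => f w ^+ 2)).

Lemma square_integrable_mul f g : square_integrable f -> square_integrable g ->
  P.-integrable setT (EFin \o (fun w => f w * g w)).
Proof.
move=> [mf fi] [mg gi].
apply: (@integrable_le _ _ _ _ _ (fun w => f w ^+ 2 + g w ^+ 2)).
- exact: measurable_funM.
- exact: integrable_addR.
- by move=> w; rewrite ler_norml; apply/andP; split; nra.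
Qed.

Lemma square_integrable_le f g : measurable_fun setT f -> square_integrable g ->
  (forall w, `|f w| <= `|g w|) -> square_integrable f.
Proof.
move=> mf [mg gi] fg; split=> //.
apply: (@integrable_le _ _ _ _ _ (fun w => g w ^+ 2)) => //.
  exact: measurable_funX.
move=> w; rewrite ger0_norm ?sqr_ge0// -[leLHS]real_normK ?num_real//.
by rewrite -[leRHS]real_normK ?num_real// lerXn2r// nnegrE.
Qed.

Lemma square_integrable_sub f g : square_integrable f -> square_integrable g ->
  square_integrable (fun w => f w - g w).
Proof.
move=> sf sg; have [mf fi] := sf; have [mg gi] := sg.
split; first exact: measurable_funB.
apply: (@integrable_le _ _ _ _ _ (fun w => 2 * (f w ^+ 2 + g w ^+ 2))).
- by apply: measurable_funX; exact: measurable_funB.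
- by apply: integrable_scaleR; exact: integrable_addR.
- move=> w; rewrite ger0_norm ?sqr_ge0//.
  by have := sqr_ge0 (f w + g w); nra.
Qed.

Lemma Rintegral_mul_subr (f g f' g' : Omega -> R) :
  square_integrable f -> square_integrable g ->
  square_integrable f' -> square_integrable g' ->
  \int[P]_w ((f w - g w) * (f' w - g' w)) =
  \int[P]_w (f w * f' w) - \int[P]_w (f w * g' w) -
  (\int[P]_w (g w * f' w) - \int[P]_w (g w * g' w)).
Proof.
move=> sf sg sf' sg'.
rewrite -!RintegralB ?square_integrable_mul//; last 2 first.
- by apply: integrable_subR; exact: square_integrable_mul.
- by apply: integrable_subR; exact: square_integrable_mul.
by apply: eq_Rintegral => w _; ring.
Qed.

Lemma integrable_sumR (I : Type) (r : seq I) (F : I -> Omega -> R) :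
  (forall i, P.-integrable setT (EFin \o F i)) ->
  P.-integrable setT (EFin \o (fun w => \sum_(i <- r) F i w)).
Proof.
move=> Fi; elim: r => [|i r IH].
  by under eq_fun do rewrite big_nil; exact: integrable_cstR.
by under eq_fun do rewrite big_cons; exact: integrable_addR.
Qed.

Lemma Rintegral_sum (I : Type) (r : seq I) (F : I -> Omega -> R) :
  (forall i, P.-integrable setT (EFin \o F i)) ->
  \int[P]_w (\sum_(i <- r) F i w) = \sum_(i <- r) \int[P]_w F i w.
Proof.
move=> Fi; elim: r => [|i r IH].
  under eq_Rintegral do rewrite big_nil.
  by rewrite big_nil Rintegral_probability_cst.
under eq_Rintegral do rewrite big_cons.
by rewrite big_cons RintegralD ?IH//; exact: integrable_sumR.
Qed.

Context {n : nat}.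
Variables (f : 'I_n -> Omega -> R) (A : 'M[R]_n) (V : Omega -> 'rV[R]_n).
Hypothesis fi : forall i j, P.-integrable setT (EFin \o (fun w => f i w * f j w)).
Hypothesis Vf : forall w i, V w 0 i = f i w.

Let bformV w : bform A (V w) (V w) = \sum_i \sum_j A i j * (f i w * f j w).
Proof.
rewrite bformE; apply: eq_bigr => i _; apply: eq_bigr => j _.
by rewrite !Vf; ring.
Qed.

Lemma integrable_bform : P.-integrable setT (EFin \o (fun w => bform A (V w) (V w))).
Proof.
under eq_fun do rewrite bformV.
by apply: integrable_sumR => i; apply: integrable_sumR => j; exact: integrable_scaleR.
Qed.

Lemma Rintegral_bform : \int[P]_w bform A (V w) (V w) =
  \sum_i \sum_j A i j * \int[P]_w (f i w * f j w).
Proof.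
under eq_Rintegral do rewrite bformV.
rewrite Rintegral_sum => [|i]; last first.
  by apply: integrable_sumR => j; exact: integrable_scaleR.
apply: eq_bigr => i _; rewrite Rintegral_sum => [|j]; last exact: integrable_scaleR.
by apply: eq_bigr => j _; rewrite RintegralZl.
Qed.

End second_moments.

Section transfer.
Context {R : realType} {d d' : measure_display} {Omega : measurableType d}
  {T : measurableType d'} (P : probability Omega R) (X : {RV P >-> T}).

Lemma integrable_distribution (f : T -> R) : measurable_fun setT f ->
  (distribution P X).-integrable setT (EFin \o f) ->
  P.-integrable setT (EFin \o (fun w => f (X w))).
Proof.
move=> mf /integrableP[_ foo]; apply/integrableP; split.
  by apply/measurable_EFinP; exact: measurableT_comp.
rewrite ge0_integral_distribution// in foo.
by apply: measurableT_comp => //; exact/measurable_EFinP.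
Qed.

Lemma Rintegral_distribution (f : T -> R) : measurable_fun setT f ->
  (distribution P X).-integrable setT (EFin \o f) ->
  \int[distribution P X]_t f t = \int[P]_w f (X w).
Proof.
move=> mf fi; rewrite /Rintegral integral_distribution//.
  exact/measurable_EFinP.
exact: integrable_distribution.
Qed.

End transfer.

(** * Lower bound *)

Section converse.
Context {R : realType} {m : nat} {d d' : measure_display}
  {Omega : measurableType d} {T : measurableType d'} (P : probability Omega R)
  (U : {RV P >-> T}) (Y : 'I_m -> {RV P >-> R}).
Variables (mu : 'rV[R]_m) (Sigma : 'M[R]_m).
Hypotheses (pSigma : posdefmx Sigma) (detSigma : 0 < \det Sigma).
Hypothesis lawY : forall A, measurable A -> (distribution P (rvector Y) A =
  \int[lebesgue_tuple m]_(x in A) (gaussian_density mu Sigma x)%:E)%E.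
Hypothesis ciY : mutually_cond_independent U Y.

Let uSigma := posdefmx_unit pSigma.
Let sSigma : Sigma^T = Sigma. Proof. by case: pSigma. Qed.

Let c0 : 0 <= (Num.sqrt ((2 * pi) ^+ m * \det Sigma))^-1.
Proof. by rewrite invr_ge0 sqrtr_ge0. Qed.

Let mU : measurable_fun setT U. Proof. exact: measurable_funPT. Qed.

Let mYi i : measurable_fun setT (Y i). Proof. exact: measurable_funPT. Qed.

Let mtnth i j : measurable_fun setT
  (fun t : m.-tuple R => (tnth t i - mu 0 i) * (tnth t j - mu 0 j)).
Proof.
by apply: measurable_funM; apply: measurable_funB => //; exact: measurable_tnth.
Qed.

Let iPY i j := gaussian_integrable2 (Q := distribution P (rvector Y)) sSigma (mulmxV uSigma) c0 lawY i j.

Let Z i w := Y i w - mu 0 i.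

Let ZE i w : Z i w = tnth (rvector Y w) i - mu 0 i.
Proof. by rewrite tnth_mktuple. Qed.

Let ZZi i j : P.-integrable setT (EFin \o (fun w => Z i w * Z j w)).
Proof.
have := integrable_distribution (mtnth i j) (iPY i j).
by under eq_fun do rewrite -!ZE.
Qed.

Let ZZ i j : \int[P]_w (Z i w * Z j w) = Sigma i j.
Proof.
rewrite -(gaussian_covariance (Q := distribution P (rvector Y)) sSigma (mulmxV uSigma) c0 lawY i j).
rewrite (Rintegral_distribution (mtnth i j) (iPY i j)).
by apply: eq_Rintegral => w _; rewrite !ZE.
Qed.

Let mZ i : measurable_fun setT (Z i). Proof. exact: measurable_funB. Qed.

Let sZ i : square_integrable P (Z i).
Proof. by split=> //; have := ZZi i i; under eq_fun do rewrite -expr2. Qed.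

(** Conditional expectations are available for nonnegative functions only, so the centred variable
    is split into its positive part ([s = true]) and its negative part ([s = false]). *)
Let part (s : bool) j (x : R) := Num.max (if s then x - mu 0 j else mu 0 j - x) 0.

Let mpart s j : measurable_fun setT (part s j).
Proof.
by apply: measurable_maxr => //; case: s; exact: measurable_funB.
Qed.

Let part_ge0 s j x : 0 <= part s j x.
Proof. by rewrite le_max lexx orbT. Qed.

Let partE j w : part true j (Y j w) - part false j (Y j w) = Z j w.
Proof.
rewrite /part /Z; set x := Y j w; set a := mu 0 j.
have [xa|/ltW xa] := lerP a x.
  by rewrite max_l ?subr_ge0// max_r ?subr_le0// subr0.
by rewrite max_r ?subr_le0// max_l ?subr_ge0// sub0r opprB.
Qed.

Let spart s j : square_integrable P (part s j \o Y j).
Proof.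
apply: (square_integrable_le _ (sZ j)) => [|w].
  exact: measurableT_comp.
rewrite /= ger0_norm// /part ge_max normr_ge0 andbT.
by case: s; rewrite ?ler_norm// distrC ler_norm.
Qed.

Let part_fin s j : (\int[P]_w (part s j (Y j w))%:E < +oo)%E.
Proof.
have : P.-integrable setT (EFin \o (fun w => part s j (Y j w))).
  apply: (@integrable_le _ _ _ _ _ (fun w => 1 + part s j (Y j w) ^+ 2)).
  - exact: (spart s j).1.
  - by apply: integrable_addR; [exact: integrable_cstR|exact: (spart s j).2].
  - by move=> w; rewrite ler_norml; apply/andP; split; nra.
by move/integrable_fin_num => /(_ measurableT) /fin_numPlt/andP[].
Qed.

Let gam_ex : exists g : bool -> 'I_m -> T -> R,
  forall s j, is_cond_exp U (part s j \o Y j) (g s j).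
Proof.
have H (p : bool * 'I_m) : exists g, is_cond_exp U (part p.1 p.2 \o Y p.2) g.
  apply: cond_exp_exists => //.
  - exact: (spart p.1 p.2).1.
  - by move=> w; exact: part_ge0.
  - exact: part_fin.
by have [g gP] := choice H; exists (fun s j => g (s, j)) => s j; exact: (gP (s, j)).
Qed.

Let gam := sval (cid gam_ex).
Let gamP s j : is_cond_exp U (part s j \o Y j) (gam s j) := svalP (cid gam_ex) s j.

Let mgam s j : measurable_fun setT (gam s j). Proof. by case: (gamP s j). Qed.
Let gam_ge0 s j t : 0 <= gam s j t. Proof. by case: (gamP s j). Qed.

Let sgam s j : square_integrable P (gam s j \o U).
Proof.
split; first exact: measurableT_comp.
apply/integrableP; split.
  by apply/measurable_EFinP/measurable_funX; exact: measurableT_comp.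
under eq_integral do rewrite /= ger0_norm ?sqr_ge0//.
have [mp /integrableP[_ pi]] := spart s j.
have pi2 : (\int[P]_w ((part s j \o Y j) w ^+ 2)%:E < +oo)%E.
  by move: pi; under eq_integral do rewrite /= ger0_norm ?sqr_ge0//.
apply: le_lt_trans pi2; apply: cond_exp_sqr => //.
- by move=> w; exact: part_ge0.
- by have [_ /integrableP[_]] := spart s j; under eq_integral do rewrite /= ger0_norm ?sqr_ge0//.
Qed.

Let M j t := gam true j t - gam false j t.

Let mM j : measurable_fun setT (M j). Proof. exact: measurable_funB. Qed.

Let sM j : square_integrable P (fun w => M j (U w)).
Proof. by have := square_integrable_sub (sgam true j) (sgam false j). Qed.

Let pg s i s' j : \int[P]_w (part s i (Y i w) * gam s' j (U w)) =
  \int[P]_w (gam s i (U w) * gam s' j (U w)).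
Proof. by congr fine; have [_ _] := gamP s i; apply. Qed.

Let pp s i s' j : i != j -> \int[P]_w (part s i (Y i w) * part s' j (Y j w)) =
  \int[P]_w (part s i (Y i w) * gam s' j (U w)).
Proof. by move=> ij; congr fine; apply: (cond_independent_cross ciY ij). Qed.

Let N i j := \int[P]_w (M i (U w) * M j (U w)).

(** The defining property of conditional expectation, tested on functions of U and applied to the
    four products of positive and negative parts. *)
Let ZM i j : \int[P]_w (Z i w * M j (U w)) = N i j.
Proof.
under eq_Rintegral do rewrite -partE.
rewrite (Rintegral_mul_subr (spart true i) (spart false i) (sgam true j) (sgam false j)).
rewrite /N (Rintegral_mul_subr (sgam true i) (sgam false i) (sgam true j) (sgam false j)).
by rewrite !pg.
Qed.

(** For distinct indices conditional independence allows [Z j] to be replaced by [M j (U w)] in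
    E[Z_i Z_j]; the preceding identity then replaces [Z i] as well. *)
Let ZZ_neq i j : i != j -> Sigma i j = N i j.
Proof.
move=> ij; rewrite -ZM -ZZ.
under eq_Rintegral do rewrite -!partE.
under [RHS]eq_Rintegral do rewrite -!partE.
rewrite (Rintegral_mul_subr (spart true i) (spart false i) (spart true j) (spart false j)).
rewrite (Rintegral_mul_subr (spart true i) (spart false i) (sgam true j) (sgam false j)).
by rewrite /= !pp.
Qed.

Let res i w := Z i w - M i (U w).

Let sres i : square_integrable P (res i).
Proof. exact: square_integrable_sub. Qed.

Let res2 i : \int[P]_w (res i w * res i w) = Sigma i i - N i i.
Proof.
rewrite (Rintegral_mul_subr (sZ i) (sM i) (sZ i) (sM i)) ZZ ZM.
have -> : \int[P]_w (M i (U w) * Z i w) = N i i.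
  by rewrite -ZM; apply: eq_Rintegral => w _; rewrite mulrC.
by rewrite -/(N i i) subrr subr0.
Qed.

(* The error covariance Lam = Sigma - N is diagonal by conditional independence,
   and N, being a Gram matrix, is positive semidefinite. *)
Let Lam := diag_mx (\row_i (Sigma i i - N i i)).

Let Nsemi : possemidefmx (\matrix_(i, j) N i j).
Proof.
split; first by apply/matrixP => i j; rewrite !mxE; apply: eq_Rintegral => w _; rewrite mulrC.
move=> u; rewrite -/(bform _ u u).
pose V w := \row_i M i (U w).
(* The square of the scalar product of u and V is written as the quadratic form of the rank-one
   matrix [u^T *m u] at V, so that the formula for expected quadratic forms applies. *)
have -> : bform (\matrix_(i, j) N i j) u u = \int[P]_w bform (u^T *m u) (V w) (V w).
  rewrite (Rintegral_bform (f := fun i w => M i (U w))).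
  - rewrite bformE; apply: eq_bigr => i _; apply: eq_bigr => j _.
    by rewrite !mxE big_ord1 !mxE -/(N i j); ring.
  - by move=> i j; exact: square_integrable_mul.
  - by move=> w i; rewrite mxE.
apply: Rintegral_ge0 => w _.
rewrite /bform mulmxA -mulmxA.
rewrite (_ : u *m _ = (V w *m u^T)^T); last by rewrite trmx_mul trmxK.
by rewrite mxE big_ord1 [X in _ * X]mxE -expr2 sqr_ge0.
Qed.

Let SigmaLam : Sigma - Lam = \matrix_(i, j) N i j.
Proof.
apply/matrixP => i j; rewrite !mxE.
case: eqVneq => [->|ij]; first by rewrite mulr1n opprB addrC subrK.
by rewrite mulr0n subr0 ZZ_neq.
Qed.

Let Lam_ge0 i : 0 <= Sigma i i - N i i.
Proof. by rewrite -res2; apply: Rintegral_ge0 => w _; rewrite -expr2 sqr_ge0. Qed.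

Let Mrow t := \row_i M i t.

Lemma mutual_information_ge_diag (b : R) (D : 'M[R]_m) : 1 < b ->
  is_diag_mx D -> (forall i, 0 < D i i) ->
  (((2^-1 * ln (\det Sigma / \det D) - (\sum_i (Sigma i i - N i i) / D i i) / 2 + m%:R / 2) / ln b)%:E
   <= mutual_information b U (rvector Y))%E.
Proof.
move=> b1 dD D0; have detD := det_diag_gt0 dD D0.
pose C := 2^-1 * ln (\det Sigma / \det D).
pose f (p : T * m.-tuple R) : R :=
  C - bform (invmx D) (row_of_tuple p.2 - (mu + Mrow p.1)) (row_of_tuple p.2 - (mu + Mrow p.1)) / 2
  + bform (invmx Sigma) (row_of_tuple p.2 - mu) (row_of_tuple p.2 - mu) / 2.
have mcoord (a : 'rV[R]_m) i : measurable_fun setT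
    (fun p : T * m.-tuple R => (row_of_tuple p.2 - a) 0 i).
  exact: (measurableT_comp (measurable_row_of_tuple a i) measurable_snd).
have mres i : measurable_fun setT
    (fun p : T * m.-tuple R => (row_of_tuple p.2 - (mu + Mrow p.1)) 0 i).
  have -> : (fun p : T * m.-tuple R => (row_of_tuple p.2 - (mu + Mrow p.1)) 0 i) =
      (fun p => (row_of_tuple p.2 - mu) 0 i - M i p.1).
    by apply/funext => p; rewrite !mxE opprD addrA.
  by apply: measurable_funB => //; exact: (measurableT_comp (mM i) measurable_fst).
have mf : measurable_fun setT f.
  apply: measurable_funD.
    apply: measurable_funB => //; apply: measurable_funM => //.
    exact: measurable_bform.
  by apply: measurable_funM => //; exact: measurable_bform.
pose W := rpair U (rvector Y).
have fW w : f (W w) = C - bform (invmx D) (\row_i res i w) (\row_i res i w) / 2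
    + bform (invmx Sigma) (\row_i Z i w) (\row_i Z i w) / 2.
  rewrite /f /W /rpair /=.
  have -> : row_of_tuple (rvector Y w) - (mu + Mrow (U w)) = \row_i res i w.
    by apply/rowP => i; rewrite !mxE tnth_mktuple /res /Z opprD addrA.
  have -> // : row_of_tuple (rvector Y w) - mu = \row_i Z i w.
  by apply/rowP => i; rewrite !mxE tnth_mktuple.
have resi i j : P.-integrable setT (EFin \o (fun w => res i w * res j w)).
  exact: square_integrable_mul.
have i1 : P.-integrable setT (EFin \o (fun w => bform (invmx D) (\row_i res i w) (\row_i res i w))).
  by apply: (integrable_bform (f := res)) => // w i; rewrite mxE.
have i2 : P.-integrable setT (EFin \o (fun w => bform (invmx Sigma) (\row_i Z i w) (\row_i Z i w))).
  by apply: (integrable_bform (f := Z)) => // w i; rewrite mxE.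
have i1' : P.-integrable setT (EFin \o (fun w => bform (invmx D) (\row_i res i w) (\row_i res i w) / 2)).
  by under eq_fun do rewrite mulrC; exact: integrable_scaleR.
have i2' : P.-integrable setT (EFin \o (fun w => bform (invmx Sigma) (\row_i Z i w) (\row_i Z i w) / 2)).
  by under eq_fun do rewrite mulrC; exact: integrable_scaleR.
have i3 : P.-integrable setT (EFin \o (fun w => C - bform (invmx D) (\row_i res i w) (\row_i res i w) / 2)).
  by apply: integrable_subR => //; exact: integrable_cstR.
have fWi : P.-integrable setT (EFin \o (fun w => f (W w))).
  by under eq_fun do rewrite fW; exact: integrable_addR.
have fi : (distribution P W).-integrable setT (EFin \o f).
  apply/integrableP; split; first exact/measurable_EFinP.
  rewrite ge0_integral_distribution//; last first.
    by apply: measurableT_comp => //; exact/measurable_EFinP.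
  by case/integrableP : fWi.
have Ef : \int[distribution P W]_p f p =
    C - (\sum_i (Sigma i i - N i i) / D i i) / 2 + m%:R / 2.
  rewrite (Rintegral_distribution mf fi).
  under eq_Rintegral do rewrite fW.
  rewrite RintegralD// RintegralB//; last exact: integrable_cstR.
  rewrite Rintegral_probability_cst !RintegralZr//.
  rewrite (Rintegral_bform (f := res))//; last by move=> w i; rewrite mxE.
  rewrite (Rintegral_bform (f := Z))//; last by move=> w i; rewrite mxE.
  (* As [invmx D] is diagonal, the residual form only involves the mean square errors; the form in
     [Z] has expectation the trace of Sigma^-1 Sigma, that is m. *)
  congr (_ - _ / 2 + _ / 2).
    apply: eq_bigr => i _; rewrite invmx_diag// (bigD1 i)//= big1 ?addr0.
      by rewrite !mxE eqxx mulr1n res2 mulrC.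
    by move=> j ji; rewrite !mxE eq_sym (negPf ji) mulr0n mul0r.
  transitivity (\tr (invmx Sigma *m Sigma)); last by rewrite mulVmx// mxtrace1.
  apply: eq_bigr => i _; rewrite mxE; apply: eq_bigr => j _.
  by congr (_ * _); rewrite ZZ -[in LHS]sSigma mxE.
rewrite -/C -Ef; apply: kl_divergence_ge => //.
rewrite fubini_tonelli1//; last first.
  by apply/measurable_EFinP; exact: measurableT_comp.
(* For fixed u, e^f times the density of Y is the density of N(mu + M(u), D), of mass 1. *)
rewrite (_ : fubini_F _ _ = cst 1%E); last first.
  apply/funext => u; rewrite /fubini_F /=.
  rewrite (ge0_integral_density (mu := lebesgue_tuple m)
     (measurable_gaussian_density mu Sigma) (gaussian_density_ge0 mu Sigma) lawY); last 2 first.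
  - apply/measurable_EFinP; apply: measurableT_comp => //.
    exact: (measurableT_comp mf (measurable_pair1 u)).
  - by move=> x; rewrite lee_fin expR_ge0.
  rewrite -(integral_gaussian_density_diag (mu + Mrow u) dD D0).
  by apply: eq_integral => x _; rewrite -EFinM (gaussian_density_ratio _ mu x detD detSigma).
by rewrite (integral_probability_cst _ 1).
Qed.

(** [D] is both the test covariance and a feasible point, so no limit of determinants is taken: the
    whole loss is the explicit term in t. *)
Lemma mutual_information_ge (b : R) (t : R) : 1 < b -> 0 < t -> t < 1 ->
  exists D : 'M[R]_m, [/\ is_diag_mx D, forall i, 0 < D i i, loewner_le D Sigma &
   ((2^-1 * logb b (\det Sigma / \det D) - (m%:R / 2 * ((1 - t)^-1 - 1)) / ln b)%:E
   <= mutual_information b U (rvector Y))%E].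
Proof.
move=> b1 t0 t1; have [c c0' cle] := posdefmx_coercive pSigma.
pose D := (1 - t) *: Lam + (t * c)%:M.
have Dii i : D i i = (1 - t) * (Sigma i i - N i i) + t * c.
  by rewrite !mxE eqxx !mulr1n.
have D0 i : 0 < D i i.
  by rewrite Dii ltr_wpDl ?mulr_ge0 ?Lam_ge0 ?subr_ge0 ?(ltW t1)// mulr_gt0.
have dD : is_diag_mx D.
  apply/is_diag_mxP => i j ij; rewrite !mxE.
  have -> : (i == j) = false by apply/negbTE.
  by rewrite !mulr0n mulr0 addr0.
have DSigma : loewner_le D Sigma.
  split.
    rewrite linearB /= sSigma; congr (_ - _).
    apply/matrixP => i j; rewrite !mxE eq_sym; case: eqVneq => [->//|_].
    by rewrite !mulr0n.
  move=> u; rewrite -/(bform _ u u).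
  have -> : bform (Sigma - D) u u = (1 - t) * bform (Sigma - Lam) u u +
      t * (bform Sigma u u - c * bform 1%:M u u).
    by rewrite /D -scalemx1 !(bformDmx, bformNmx, bformZmx); ring.
  rewrite addr_ge0// mulr_ge0 ?subr_ge0 ?(ltW t0) ?(ltW t1)//.
  by rewrite SigmaLam; exact: bform_ge0.
exists D; split=> //; apply: le_trans (mutual_information_ge_diag b1 dD D0).
have lnb : 0 < ln b by rewrite ln_gt0.
rewrite lee_fin /logb mulrA -mulrBl ler_pM2r ?invr_gt0//.
(* [D] dominates (1 - t) Lam entrywise on the diagonal, so each ratio is at most (1 - t)^-1, even
   where the entry of Lam is 0. *)
have tr_le : \sum_i (Sigma i i - N i i) / D i i <= m%:R * (1 - t)^-1.
  rewrite mulr_natl -[m in leRHS]card_ord -sumr_const; apply: ler_sum => i _.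
  rewrite ler_pdivrMr// ler_pdivlMl ?subr_gt0// Dii lerDl mulr_ge0// ltW//.
lra.
Qed.

End converse.

(** * Upper bound *)

Section measurable_packing.
Context {d d' : measure_display} {T : measurableType d} {T' : measurableType d'}.

Definition mfun_of (f : T -> T') (mf : measurable_fun setT f) : {mfun T >-> T'} :=
  HB.pack f (isMeasurableFun.Build _ _ _ _ f mf).

End measurable_packing.

(** Two ways of writing the exponent of one joint Gaussian law: y of covariance Sigma followed by
    the backward kernel, or u of covariance G followed by noise of covariance Lam. After expansion
    [HG] settles the cross terms, and [HG] with [SGL] the terms in y alone. *)
Lemma complete_square {R : realType} {n : nat} (Sigma Lam : 'M[R]_n) (y u : 'rV[R]_n) :
  Sigma \in unitmx -> Lam \in unitmx -> Sigma - Lam \in unitmx ->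
  Sigma^T = Sigma -> Lam^T = Lam ->
  bform (invmx Sigma) y y +
    bform (invmx (Sigma - Lam) + invmx Lam) (u - y *m (invmx Sigma *m (Sigma - Lam)))
      (u - y *m (invmx Sigma *m (Sigma - Lam))) =
  bform (invmx (Sigma - Lam)) u u + bform (invmx Lam) (y - u) (y - u).
Proof.
set G := Sigma - Lam => uS uL uG sS sL.
have sG : G^T = G by rewrite linearB /= sS sL.
have sH : (invmx G + invmx Lam)^T = invmx G + invmx Lam.
  by rewrite linearD /= !trmx_inv sG sL.
have iSG : (invmx Sigma *m G)^T = G *m invmx Sigma by rewrite trmx_mul trmx_inv sS sG.
have HG : (invmx G + invmx Lam) *m (G *m invmx Sigma) = invmx Lam.
  rewrite mulmxA mulmxDl mulVmx// -(mulVmx uL) -mulmxDr addrC /G subrK.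
  by rewrite -mulmxA mulmxV// mulmx1.
have SGL : invmx Sigma *m G *m invmx Lam = invmx Lam - invmx Sigma.
  by rewrite /G mulmxBr mulVmx// mulmxBl mul1mx -mulmxA mulmxV// mulmx1.
rewrite !(bformDl, bformDr, bformNl, bformNr).
rewrite (bformC _ u sH) !bform_mulr iSG HG !bform_mull SGL.
rewrite !(bformDmx, bformNmx) (bformC u y) ?trmx_inv ?sL//.
by ring.
Qed.

Lemma prod_indic {R : realType} {n : nat} (C : 'I_n -> set R) (x : 'I_n -> R) :
  \prod_i \1_(C i) (x i) = (`[< forall i, C i (x i) >])%:R :> R.
Proof.
case: (pselect (forall i, C i (x i))) => [H|H].
  by rewrite asboolT// big1// => i _; rewrite indicE mem_set.
rewrite asboolF//; have [i Hi] := (existsNP _).2 H.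
by rewrite (bigD1 i)//= indicE memNset// mul0r.
Qed.

(** * Reversing a channel given by densities *)

Section backward_channel.
Local Open Scope ereal_scope.
Context {R : realType} {d1 d2 : measure_display} {T1 : measurableType d1}
  {T2 : measurableType d2}.
Variables (m1 : {sigma_finite_measure set T1 -> \bar R})
  (m2 : {sigma_finite_measure set T2 -> \bar R}) (PX : probability T2 R).
Variables (p : T2 -> R) (k : T1 * T2 -> R) (a : T1 -> R) (q : T1 * T2 -> R).
Hypotheses (mp : measurable_fun setT p) (p0 : forall y, (0 <= p y)%R).
Hypotheses (mk : measurable_fun setT k) (k0 : forall w, (0 <= k w)%R).
Hypothesis a0 : forall u, (0 <= a u)%R.
Hypotheses (mq : measurable_fun setT q) (q0 : forall w, (0 <= q w)%R).
Hypothesis lawX : forall A, measurable A -> PX A = \int[m2]_(y in A) (p y)%:E.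
Hypothesis intk : forall y, \int[m1]_u (k (u, y))%:E = 1.
Hypothesis intq : forall u, \int[m2]_y (q (u, y))%:E = 1.
Hypothesis factor : forall u y, (p y * k (u, y) = a u * q (u, y))%R.

Let kE : measurable_fun setT (EFin \o k). Proof. exact/measurable_EFinP. Qed.

Let k1 : \int[m1 \x PX]_w (k w)%:E = 1.
Proof.
rewrite (fubini_tonelli2 (EFin \o k))//.
rewrite (_ : fubini_G _ _ = cst 1); first by rewrite (integral_probability_cst PX 1).
by apply/funext => y; exact: intk.
Qed.

Let Q : probability (T1 * T2)%type R := density_probability mk k0 k1.

(** Tonelli in both orders, with the factorisation p k = a q applied to the integrand in between. *)
Let intQ (phi : T1 * T2 -> \bar R) :
  measurable_fun setT phi -> (forall w, 0 <= phi w) ->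
  \int[Q]_w phi w = \int[m1]_u ((a u)%:E * \int[m2]_y ((q (u, y))%:E * phi (u, y))).
Proof.
move=> mphi phi0.
have mkphi : measurable_fun setT (fun w => (k w)%:E * phi w).
  exact: emeasurable_funM.
have kphi0 w : 0 <= (k w)%:E * phi w by rewrite mule_ge0// lee_fin.
rewrite (ge0_integral_density (mu := m1 \x PX) mk k0)//.
rewrite (fubini_tonelli2 (fun w => (k w)%:E * phi w))//.
have mG := measurable_fun_fubini_tonelli_G (m1 := m1) _ mkphi kphi0.
have G0 y : 0 <= fubini_G m1 (fun w => (k w)%:E * phi w) y by exact: integral_ge0.
rewrite (@ge0_integral_density _ _ _ PX m2 _ mp p0 lawX _ mG G0).
have mpk : measurable_fun setT (fun w : T1 * T2 => (p w.2)%:E * ((k w)%:E * phi w)).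
  apply: emeasurable_funM => //; apply/measurable_EFinP.
  exact: (measurableT_comp mp measurable_snd).
have pk0 (w : T1 * T2) : 0 <= (p w.2)%:E * ((k w)%:E * phi w).
  by rewrite mule_ge0// lee_fin.
transitivity (\int[m2]_y \int[m1]_u ((p y)%:E * ((k (u, y))%:E * phi (u, y)))).
  apply: eq_integral => y _; rewrite ge0_integralZl ?lee_fin//.
  exact: (measurableT_comp mkphi (measurable_pair2 y)).
rewrite -(fubini_tonelli (m1 := m1) (m2 := m2) (fun w => (p w.2)%:E * ((k w)%:E * phi w)))//.
apply: eq_integral => u _; rewrite -ge0_integralZl ?lee_fin//.
- by apply: eq_integral => y _ /=; rewrite muleA -EFinM factor EFinM -muleA.
- apply: emeasurable_funM; last exact: (measurableT_comp mphi (measurable_pair1 u)).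
  by apply/measurable_EFinP; exact: (measurableT_comp mq (measurable_pair1 u)).
- by move=> y _; rewrite mule_ge0// lee_fin.
Qed.

Let intU (phi : T1 -> \bar R) : measurable_fun setT phi -> (forall u, 0 <= phi u) ->
  \int[Q]_w phi w.1 = \int[m1]_u ((a u)%:E * phi u).
Proof.
move=> mphi phi0; rewrite intQ//; last exact: (measurableT_comp mphi measurable_fst).
apply: eq_integral => u _; congr (_ * _); rewrite /=.
rewrite ge0_integralZr//; first by rewrite intq mul1e.
- by apply/measurable_EFinP; exact: (measurableT_comp mq (measurable_pair1 u)).
- by move=> y _; rewrite lee_fin.
Qed.

(** The factorisation hypothesis is Bayes' rule, [a] being the density of the first marginal. The
    conclusion records the second marginal and, as an integral identity instead of a kernel, that
    [q (u, y)] is the conditional density of the second component given the first. *)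
Lemma backward_channel : exists Q : probability (T1 * T2)%type R,
  (forall psi : T2 -> \bar R, measurable_fun setT psi -> (forall y, 0 <= psi y) ->
    \int[Q]_w psi w.2 = \int[PX]_y psi y) /\
  (forall phi : T1 * T2 -> \bar R, measurable_fun setT phi -> (forall w, 0 <= phi w) ->
    \int[Q]_w phi w = \int[Q]_w \int[m2]_y ((q (w.1, y))%:E * phi (w.1, y))).
Proof.
exists Q; split=> [psi mpsi psi0|phi mphi phi0].
  have mpsi2 : measurable_fun setT (fun w : T1 * T2 => psi w.2).
    exact: (measurableT_comp mpsi measurable_snd).
  rewrite (ge0_integral_density (mu := m1 \x PX) mk k0)//.
  rewrite (fubini_tonelli2 (fun w => (k w)%:E * psi w.2))//; last 2 first.
  - exact: emeasurable_funM.
  - by move=> w; rewrite mule_ge0// lee_fin.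
  apply: eq_integral => y _; rewrite /fubini_G /= ge0_integralZr//.
  - by rewrite intk mul1e.
  - exact: (measurableT_comp kE (measurable_pair2 y)).
  - by move=> u _; rewrite lee_fin.
rewrite intQ// (intU (phi := fun u => \int[m2]_y ((q (u, y))%:E * phi (u, y))))//.
- apply: (measurable_fun_fubini_tonelli_F (m2 := m2) (fun w => (q w)%:E * phi w)).
  + by apply: emeasurable_funM => //; exact/measurable_EFinP.
  + by move=> w; rewrite mule_ge0// lee_fin.
- by move=> u; apply: integral_ge0 => y _; rewrite mule_ge0// lee_fin.
Qed.

End backward_channel.

(** * The Gaussian backward channel *)

Section gaussian_channel.
Context {R : realType} {n : nat} {d : measure_display} {Omega : measurableType d}
  (P : probability Omega R) (X : 'I_n -> {RV P >-> R}).
Variables (mu : 'rV[R]_n) (Sigma Lam : 'M[R]_n).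
Hypotheses (pSigma : posdefmx Sigma) (detSigma : 0 < \det Sigma).
Hypotheses (dLam : is_diag_mx Lam) (Lam0 : forall i, 0 < Lam i i).
Hypothesis pG : posdefmx (Sigma - Lam).
Hypothesis lawX : forall A, measurable A -> (distribution P (rvector X) A =
  \int[lebesgue_tuple n]_(x in A) (gaussian_density mu Sigma x)%:E)%E.

Local Notation G := (Sigma - Lam).
Local Notation leb := (lebesgue_tuple n).
Local Notation PX := (distribution P (rvector X)).

Let detLam : 0 < \det Lam. Proof. exact: det_diag_gt0. Qed.
Let uSigma : Sigma \in unitmx. Proof. exact: posdefmx_unit. Qed.
Let uG : G \in unitmx. Proof. exact: posdefmx_unit. Qed.
Let uLam : Lam \in unitmx. Proof. by rewrite unitmxE unitfE gt_eqF. Qed.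
Let sSigma : Sigma^T = Sigma. Proof. by case: pSigma. Qed.
Let sLam : Lam^T = Lam. Proof. by rewrite (diag_mx_coef dLam) tr_diag_mx. Qed.

(* The backward channel: given X = y, the auxiliary variable is Gaussian with
   mean (y - mu) S and precision matrix H. *)
Let H := invmx G + invmx Lam.
Let S := invmx Sigma *m G.

Let h (u : n.-tuple R) := expR (- bform H (row_of_tuple u) (row_of_tuple u) / 2).

Let mrow i : measurable_fun setT (fun t : n.-tuple R => row_of_tuple t 0 i).
Proof. by under eq_fun do rewrite mxE; exact: measurable_tnth. Qed.

Let mh : measurable_fun setT h.
Proof.
apply: measurableT_comp => //; apply: measurable_funM => //.
by apply: measurableT_comp => //; exact: measurable_bform.
Qed.

Let h0 u : 0 <= h u. Proof. exact: expR_ge0. Qed.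

(** [H] dominates Lam^-1 because G^-1 is positive, so [h] is below a multiple of a normalised
    diagonal Gaussian density. *)
Let inth_fin : (\int[leb]_u (h u)%:E < +oo)%E.
Proof.
pose c := (Num.sqrt ((2 * pi) ^+ n * \det Lam))^-1.
have c0 : 0 < c by rewrite invr_gt0 sqrtr_gt0 mulr_gt0// twopiX_gt0.
have le u : h u <= c^-1 * gaussian_density 0 Lam u.
  rewrite gaussian_densityE subr0 mulrA mulVf ?gt_eqF// mul1r ler_expR.
  rewrite ler_pM2r// lerN2 /H bformDmx lerDr.
  exact/bform_ge0/posdefmx_semi/posdefmx_invmx.
apply: (@le_lt_trans _ _ (\int[leb]_u ((c^-1)%:E * (gaussian_density 0 Lam u)%:E))%E).
  apply: ge0_le_integral => //.
  - by move=> u _; rewrite lee_fin.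
  - exact/measurable_EFinP.
  - by apply/measurable_EFinP/measurable_funM => //; exact: measurable_gaussian_density.
  - by move=> u _; rewrite -EFinM lee_fin.
rewrite ge0_integralZl ?lee_fin ?invr_ge0 ?(ltW c0)//.
- by rewrite integral_gaussian_density_diag// mule1 ltry.
- by apply/measurable_EFinP; exact: measurable_gaussian_density.
- by move=> u _; rewrite lee_fin gaussian_density_ge0.
Qed.

(** [h] is positive everywhere; a zero integral would make the whole space null, against the unit
    mass of a diagonal Gaussian density. *)
Let inth_neq0 : (\int[leb]_u (h u)%:E != 0)%E.
Proof.
apply/eqP => h0'.
have : ae_eq leb setT (EFin \o h) (cst 0%E).
  apply/(ae_eq_integral_abs _ _ _).1 => //; first exact/measurable_EFinP.
  by under eq_integral do rewrite /= ger0_norm//.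
case=> N [mN N0 NE].
have NT : N = setT.
  apply/seteqP; split=> // u _; apply: NE => /= /(_ Logic.I) [] /eqP.
  by rewrite gt_eqF// expR_gt0.
have := integral_gaussian_density_diag 0 dLam Lam0.
rewrite null_set_integral//; first by move=> /eqP; rewrite eq_sym onee_eq0.
  by apply/measurable_EFinP; exact: measurable_gaussian_density.
by rewrite -NT.
Qed.

(** Normalising constant of the backward kernel. Since [H] need not be diagonal, it is defined from
    the integral instead of by a determinant. *)
Let kappa := (fine (\int[leb]_u (h u)%:E))^-1.

Let kappa_inv : (\int[leb]_u (h u)%:E = (kappa^-1)%:E)%E.
Proof.
by rewrite /kappa invrK fineK// ge0_fin_numE//; apply: integral_ge0 => u _; rewrite lee_fin.
Qed.

Let kappa_gt0 : 0 < kappa.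
Proof.
rewrite -invr_gt0 -lte_fin -kappa_inv lt0e inth_neq0/=.
by apply: integral_ge0 => u _; rewrite lee_fin.
Qed.

Let k (p : n.-tuple R * n.-tuple R) :=
  kappa * expR (- bform H (row_of_tuple p.1 - (row_of_tuple p.2 - mu) *m S)
                          (row_of_tuple p.1 - (row_of_tuple p.2 - mu) *m S) / 2).

Let mk : measurable_fun setT k.
Proof.
apply: measurable_funM => //; apply: measurableT_comp => //.
apply: measurable_funM => //; apply: measurableT_comp => //.
have mc i : measurable_fun setT (fun p : n.-tuple R * n.-tuple R =>
    (row_of_tuple p.1 - (row_of_tuple p.2 - mu) *m S) 0 i).
  under eq_fun => p do rewrite mxE [X in _ + X]mxE [X in _ - X]mxE.
  apply: measurable_funB; first exact: (measurableT_comp (mrow i) measurable_fst).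
  apply: measurable_sum => j; apply: measurable_funM => //.
  exact: (measurableT_comp (measurable_row_of_tuple mu j) measurable_snd).
exact: measurable_bform.
Qed.

Let k0 p : 0 <= k p. Proof. by rewrite mulr_ge0 ?expR_ge0// ltW. Qed.

Let intk y : (\int[leb]_u (k (u, y))%:E = 1)%E.
Proof.
have E u : (k (u, y))%:E =
    (kappa%:E * (h (shift_tuple (- ((row_of_tuple y - mu) *m S)) u))%:E)%E.
  by rewrite -EFinM /k /h row_of_shift_tuple.
under eq_integral do rewrite E.
rewrite ge0_integralZl ?lee_fin ?(ltW kappa_gt0)//; last 2 first.
- by apply/measurable_EFinP/measurableT_comp => //; exact: measurable_shift_tuple.
- by move=> u _; rewrite lee_fin.
rewrite (lebesgue_tuple_translation _ (f := fun u => (h u)%:E))//; last exact/measurable_EFinP.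
by rewrite kappa_inv -EFinM divff// gt_eqF.
Qed.

Let q u := gaussian_density (mu + row_of_tuple u) Lam.

(** The density of U, forced by Bayes' rule: the Gaussian shape of covariance G times the constants
    left over by the other three factors. *)
Let a u := kappa * (Num.sqrt ((2 * pi) ^+ n * \det Sigma))^-1 *
  Num.sqrt ((2 * pi) ^+ n * \det Lam) *
  expR (- bform (invmx G) (row_of_tuple u) (row_of_tuple u) / 2).

Let a0 u : 0 <= a u.
Proof.
apply: mulr_ge0; last exact: expR_ge0.
apply: mulr_ge0; last exact: sqrtr_ge0.
by apply: mulr_ge0; [exact: ltW|rewrite invr_ge0 sqrtr_ge0].
Qed.

Let factor u y : gaussian_density mu Sigma y * k (u, y) = a u * q u y.
Proof.
rewrite /k /a /q !gaussian_densityE /= opprD addrA.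
set z := row_of_tuple y - mu; set v := row_of_tuple u.
have D0 : Num.sqrt ((2 * pi) ^+ n * \det Lam) != 0.
  by rewrite gt_eqF// sqrtr_gt0 mulr_gt0// twopiX_gt0.
have := complete_square z v uSigma uLam uG sSigma sLam; rewrite -/H -/S.
have gen (K c c' e1 e2 e3 e4 : R) : c' != 0 -> expR e1 * expR e2 = expR e3 * expR e4 ->
    c * expR e1 * (K * expR e2) = K * c * c' * expR e3 * (c'^-1 * expR e4).
  move=> c'0 E; transitivity (K * c * (expR e1 * expR e2)); first by ring.
  by rewrite E; field.
by move=> E; apply: gen => //; rewrite -!expRD; congr expR; lra.
Qed.

Let mq : measurable_fun setT (fun p : n.-tuple R * n.-tuple R => q p.1 p.2).
Proof.
apply: measurable_funM => //; apply: measurableT_comp => //.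
apply: measurable_funM => //; apply: measurableT_comp => //.
have mc i : measurable_fun setT (fun p : n.-tuple R * n.-tuple R =>
    (row_of_tuple p.2 - (mu + row_of_tuple p.1)) 0 i).
  have -> : (fun p : n.-tuple R * n.-tuple R => (row_of_tuple p.2 - (mu + row_of_tuple p.1)) 0 i) =
      (fun p => (row_of_tuple p.2 - mu) 0 i - row_of_tuple p.1 0 i).
    by apply/funext => p; rewrite !mxE opprD addrA.
  apply: measurable_funB.
    exact: (measurableT_comp (measurable_row_of_tuple mu i) measurable_snd).
  exact: (measurableT_comp (mrow i) measurable_fst).
exact: measurable_bform.
Qed.

Let q0 u y : 0 <= q u y. Proof. exact: gaussian_density_ge0. Qed.

Let intq u : (\int[leb]_y (q u y)%:E = 1)%E.
Proof. exact: integral_gaussian_density_diag. Qed.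

Lemma gaussian_backward_channel :
  exists Q : probability (n.-tuple R * n.-tuple R)%type R,
  (forall psi : n.-tuple R -> \bar R, measurable_fun setT psi -> (forall y, 0 <= psi y)%E ->
    (\int[Q]_w psi w.2 = \int[PX]_y psi y)%E) /\
  (forall phi : n.-tuple R * n.-tuple R -> \bar R,
    measurable_fun setT phi -> (forall w, 0 <= phi w)%E ->
    (\int[Q]_w phi w = \int[Q]_w \int[leb]_y
      ((gaussian_density (mu + row_of_tuple w.1) Lam y)%:E * phi (w.1, y)))%E).
Proof.
have [Q [h1 h2]] := @backward_channel _ _ _ _ _ leb leb PX (gaussian_density mu Sigma)
  k a (fun w => q w.1 w.2) (measurable_gaussian_density mu Sigma)
  (gaussian_density_ge0 mu Sigma) mk k0 a0 mq (fun w => q0 w.1 w.2) lawX intk intq factor.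
by exists Q.
Qed.

End gaussian_channel.

(** * The coupling attached to the additive Gaussian channel *)

Section achievability.
Context {R : realType} {n : nat} {d : measure_display} {Omega : measurableType d}
  (P : probability Omega R) (X : 'I_n -> {RV P >-> R}).
Variables (mu : 'rV[R]_n) (Sigma Lam : 'M[R]_n).
Hypotheses (pSigma : posdefmx Sigma) (detSigma : 0 < \det Sigma).
Hypotheses (dLam : is_diag_mx Lam) (Lam0 : forall i, 0 < Lam i i).
Hypothesis lawX : forall A, measurable A -> (distribution P (rvector X) A =
  \int[lebesgue_tuple n]_(x in A) (gaussian_density mu Sigma x)%:E)%E.

Local Notation leb := (lebesgue_tuple n).
Local Notation PX := (distribution P (rvector X)).
Local Notation TT := (n.-tuple R * n.-tuple R)%type.

Variable Q : probability TT R.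
Hypothesis intY : forall psi : n.-tuple R -> \bar R,
  measurable_fun setT psi -> (forall y, 0 <= psi y)%E ->
  (\int[Q]_w psi w.2 = \int[PX]_y psi y)%E.
Hypothesis intcond : forall phi : TT -> \bar R,
  measurable_fun setT phi -> (forall w, 0 <= phi w)%E ->
  (\int[Q]_w phi w = \int[Q]_w \int[leb]_y
      ((gaussian_density (mu + row_of_tuple w.1) Lam y)%:E * phi (w.1, y)))%E.

Let detLam : 0 < \det Lam. Proof. exact: det_diag_gt0. Qed.
Let uSigma : Sigma \in unitmx. Proof. exact: posdefmx_unit. Qed.
Let uLam : Lam \in unitmx. Proof. by rewrite unitmxE unitfE gt_eqF. Qed.
Let sSigma : Sigma^T = Sigma. Proof. by case: pSigma. Qed.
Let sLam : Lam^T = Lam. Proof. by rewrite (diag_mx_coef dLam) tr_diag_mx. Qed.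

Let mYi i : measurable_fun setT (fun w : TT => tnth w.2 i).
Proof. exact: (measurableT_comp (measurable_tnth i) measurable_snd). Qed.

Definition channel_input : {RV Q >-> n.-tuple R} :=
  mfun_of (@measurable_fst _ _ (n.-tuple R) (n.-tuple R)).
Definition channel_output (i : 'I_n) : {RV Q >-> R} := mfun_of (mYi i).

Local Notation U := channel_input.
Local Notation Y := channel_output.

Let rvectorY w : rvector Y w = w.2.
Proof. by apply: eq_from_tnth => i; rewrite tnth_mktuple. Qed.

Let intI d0 (T : measurableType d0) (M : {measure set T -> \bar R}) (A : set T) :
  measurable A -> M A = (\int[M]_x (\1_A x)%:E)%E.
Proof. by move=> mA; rewrite integral_indic// setIT. Qed.

Lemma channel_output_law A : measurable A ->
  distribution Q (rvector Y) A = distribution P (rvector X) A.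
Proof.
move=> mA; rewrite (intI PX mA) -intY//.
- rewrite -[LHS]/(Q (rvector Y @^-1` A)).
  have -> : rvector Y @^-1` A = snd @^-1` A.
    by apply/seteqP; split=> w /=; rewrite rvectorY.
  rewrite (intI Q); first by apply: eq_integral => w _.
  by rewrite -[X in measurable X]setTI; exact: measurable_snd.
- by apply/measurable_EFinP; exact: measurable_indic.
Qed.

Let q u y := gaussian_density (mu + row_of_tuple u) Lam y.

Let qprod u y : q u y =
  \prod_i normal_pdf (mu 0 i + tnth u i) (Num.sqrt (Lam i i)) (tnth y i).
Proof.
rewrite /q gaussian_density_diagE//; apply: eq_bigr => i _.
by rewrite !mxE.
Qed.

(** The conditional probability that [Y i] lies in [B] given U = u: a normal law of mean mu_i + u_i
    and variance [Lam i i]. *)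
Let g (B : set R) i (u : n.-tuple R) : R := fine (\int[@lebesgue_measure R]_x
  (normal_pdf (mu 0 i + tnth u i) (Num.sqrt (Lam i i)) x * \1_B x)%:E)%E.

Let s0 i : Num.sqrt (Lam i i) != 0. Proof. by rewrite gt_eqF// sqrtr_gt0. Qed.

Let mnB (B : set R) i a : measurable B ->
  measurable_fun setT (fun x : R => normal_pdf a (Num.sqrt (Lam i i)) x * \1_B x).
Proof.
by move=> mB; apply: measurable_funM; [exact: measurable_normal_pdf|exact: measurable_indic].
Qed.

Let nB0 (B : set R) i a x : 0 <= normal_pdf a (Num.sqrt (Lam i i)) x * \1_B x.
Proof. by rewrite mulr_ge0// normal_pdf_ge0. Qed.

Let gE (B : set R) i u : measurable B -> (\int[@lebesgue_measure R]_x
  (normal_pdf (mu 0 i + tnth u i) (Num.sqrt (Lam i i)) x * \1_B x)%:E = (g B i u)%:E)%E.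
Proof.
move=> mB; rewrite fineK// ge0_fin_numE; last first.
  by apply: integral_ge0 => x _; rewrite lee_fin.
apply: (@le_lt_trans _ _ (\int[@lebesgue_measure R]_x
  (normal_pdf (mu 0 i + tnth u i) (Num.sqrt (Lam i i)) x)%:E)%E); last first.
  by rewrite integral_normal_pdf ltry.
apply: ge0_le_integral => //.
- by move=> x _; rewrite lee_fin.
- by apply/measurable_EFinP; exact: mnB.
- by apply/measurable_EFinP; exact: measurable_normal_pdf.
- by move=> x _; rewrite lee_fin ler_piMr ?normal_pdf_ge0// indicE lern1 leq_b1.
Qed.

Let g_ge0 B i u : 0 <= g B i u.
Proof. by apply: fine_ge0; apply: integral_ge0 => x _; rewrite lee_fin. Qed.

Let gT i u : g setT i u = 1.
Proof.
rewrite /g; under eq_integral do rewrite indicT mulr1.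
by rewrite integral_normal_pdf.
Qed.

(** The mean is made a variable of a jointly measurable integrand, so that Tonelli gives
    measurability of the integral in it. *)
Let mg B i : measurable B -> measurable_fun setT (g B i).
Proof.
move=> mB; pose F (p : R * measurableTypeR R) : \bar R :=
  (normal_pdf (mu 0 i + p.1) (Num.sqrt (Lam i i)) p.2 * \1_B p.2)%:E.
have mF : measurable_fun setT F.
  apply/measurable_EFinP; apply: measurable_funM; last first.
    exact: (measurableT_comp (measurable_indic mB) measurable_snd).
  under eq_fun do rewrite normal_pdfE//.
  apply: measurable_funM => //; apply: measurableT_comp => //.
  apply: measurable_funM => //; apply: measurableT_comp => //.
  apply: measurable_funX; apply: measurable_funB; first exact: measurable_snd.
  by apply: measurable_funD => //; exact: measurable_fst.
have F0 p : (0 <= F p)%E by rewrite lee_fin.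
have mG := measurable_fun_fubini_tonelli_F (m2 := @lebesgue_measure R) _ mF F0.
have mf : measurable_fun setT (fine \o fubini_F (@lebesgue_measure R) F).
  by apply: measurableT_comp => //; exact: mG.
exact: (measurableT_comp mf (measurable_tnth i)).
Qed.

Let intq_prod (C : 'I_n -> set R) u : (forall i, measurable (C i)) ->
  (\int[leb]_y (q u y * \prod_i \1_(C i) (tnth y i))%:E = (\prod_i g (C i) i u)%:E)%E.
Proof.
move=> mC.
under eq_integral do rewrite qprod -big_split.
rewrite (lebesgue_tuple_prod
  (f := fun i x => normal_pdf (mu 0 i + tnth u i) (Num.sqrt (Lam i i)) x * \1_(C i) x)
  (c := fun i => g (C i) i u))//.
- by move=> i; exact: mnB.
- by move=> i; exact: gE.
Qed.

Let mprodC (C : 'I_n -> set R) : (forall i, measurable (C i)) ->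
  measurable_fun setT (fun y : n.-tuple R => \prod_i \1_(C i) (tnth y i) : R).
Proof.
move=> mC; apply: measurable_prod => i _.
by apply: (measurableT_comp (measurable_indic (mC i))); exact: measurable_tnth.
Qed.

Let prodC_ge0 (C : 'I_n -> set R) (y : n.-tuple R) :
  0 <= \prod_i \1_(C i) (tnth y i) :> R.
Proof. exact: prodr_ge0. Qed.

(** As Lam is diagonal, the conditional density is a product and the integral of a product of
    indicators factors. Arbitrary families [C] cover both the joint event and, with all other sets
    equal to the line, a single coordinate. *)
Let probC (C : 'I_n -> set R) B : (forall i, measurable (C i)) -> measurable B ->
  Q ([set w | forall i, C i (Y i w)] `&` U @^-1` B) =
  (\int[distribution Q U]_(u in B) (\prod_i g (C i) i u)%:E)%E.
Proof.
move=> mC mB.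
have mUB : measurable (U @^-1` B).
  by rewrite -[X in measurable X]setTI; exact: measurable_fst.
have mYC : measurable [set w : TT | forall i, C i (Y i w)].
  rewrite (_ : [set w | _] = \bigcap_i (Y i @^-1` C i)).
    apply: fin_bigcap_measurable => // i _.
    by rewrite -[X in measurable X]setTI; exact: mYi.
  apply/seteqP; split=> w /= H' i; first by move=> _; exact: H'.
  exact: (H' i Logic.I).
have mgC : measurable_fun setT (fun u => \prod_i g (C i) i u).
  by apply: measurable_prod => i _; exact: mg.
have gC0 u : 0 <= \prod_i g (C i) i u by exact: prodr_ge0.
rewrite (intI Q); last exact: measurableI.
transitivity (\int[Q]_w (\1_B w.1 * \prod_i \1_(C i) (tnth w.2 i))%:E)%E.
  apply: eq_integral => w _; congr EFin.
  rewrite indicI /= mulrC; congr (_ * _).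
  by rewrite prod_indic indicE; congr ((_ : bool)%:R); apply/idP/asboolP; rewrite inE.
rewrite intcond; last 2 first.
- apply/measurable_EFinP; apply: measurable_funM.
    exact: (measurableT_comp (measurable_indic mB) measurable_fst).
  exact: (measurableT_comp (mprodC mC) measurable_snd).
- by move=> w; rewrite lee_fin mulr_ge0.
rewrite [RHS]integral_mkcond ge0_integral_distribution; last 2 first.
- by apply/(measurable_restrictT _ _).1 => //; apply/measurable_funTS/measurable_EFinP.
- by move=> u; rewrite patchE; case: ifP => //; rewrite lee_fin.
apply: eq_integral => w _ /=.
transitivity (\int[leb]_y ((\1_B w.1)%:E * (q w.1 y * \prod_i \1_(C i) (tnth y i))%:E))%E.
  by apply: eq_integral => y _; rewrite -!EFinM mulrCA.
rewrite ge0_integralZl//; last 2 first.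
- apply/measurable_EFinP/measurable_funM; last exact: mprodC.
  exact: measurable_gaussian_density.
- by move=> y _; rewrite lee_fin mulr_ge0// gaussian_density_ge0.
rewrite intq_prod// patchE indicE.
by case: ifP => _; rewrite ?mul1e ?mul0e.
Qed.

Lemma channel_cond_independent : mutually_cond_independent U Y.
Proof.
move=> B mB; exists (fun i => g (B i) i); split=> [i|].
  split=> [|A mA]; first exact: mg.
  pose C j := if j == i then B i else setT.
  have mC j : measurable (C j) by rewrite /C; case: ifP.
  have -> : Y i @^-1` B i = [set w | forall j, C j (Y j w)].
    apply/seteqP; split=> w /=; last by move=> /(_ i); rewrite /C eqxx.
    by move=> Bw j; rewrite /C; case: eqVneq => [->|].
  rewrite probC//; apply: eq_integral => u _; congr EFin.
  rewrite (bigD1 i)//= big1 ?mulr1 ?/C ?eqxx// => j ji.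
  by rewrite (negPf ji) gT.
split; first by apply: measurable_prod => i _; exact: mg.
by move=> A mA; exact: probC.
Qed.

Let mrow i : measurable_fun setT (fun t : n.-tuple R => row_of_tuple t 0 i).
Proof. by under eq_fun do rewrite mxE; exact: measurable_tnth. Qed.

Let mnoise : measurable_fun setT
  (fun w : TT => shift_tuple (- row_of_tuple w.1) w.2).
Proof.
apply/measurable_fun_tnthP => i.
rewrite (_ : _ \o _ = fun w : TT => tnth w.2 i - tnth w.1 i).
  apply: measurable_funB; first exact: mYi.
  exact: (measurableT_comp (measurable_tnth i) measurable_fst).
by apply/funext => w /=; rewrite tnth_mktuple !mxE.
Qed.

(** The channel noise Y - U, not centred: keeping the mean [mu] lets the same moment lemmas serve
    for [V] and for Y. *)
Let V : {RV Q >-> n.-tuple R} := mfun_of mnoise.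

Let lawV A : measurable A -> (distribution Q V A =
  \int[leb]_(x in A) (gaussian_density mu Lam x)%:E)%E.
Proof.
move=> mA.
have mVA : measurable (V @^-1` A) by rewrite -[X in measurable X]setTI; exact: mnoise.
have mgA : measurable_fun setT (fun x => gaussian_density mu Lam x * \1_A x).
  by apply: measurable_funM; [exact: measurable_gaussian_density|exact: measurable_indic].
have gA0 x : 0 <= gaussian_density mu Lam x * \1_A x.
  by rewrite mulr_ge0// gaussian_density_ge0.
rewrite -[LHS]/(Q (V @^-1` A)) (intI Q mVA).
transitivity (\int[Q]_w (\1_A (V w))%:E)%E.
  by apply: eq_integral => w _; rewrite !indicE; congr ((_ : bool)%:R%:E); apply/idP/idP; rewrite !inE.
rewrite (intcond (phi := fun w => (\1_A (V w))%:E)); last 2 first.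
- by apply/measurable_EFinP; exact: (measurableT_comp (measurable_indic mA) mnoise).
- by move=> w; rewrite lee_fin.
pose F x := (gaussian_density mu Lam x * \1_A x)%:E.
have mF : measurable_fun setT F by exact/measurable_EFinP.
have F0 x : (0 <= F x)%E by rewrite lee_fin.
(* Translating by u removes the dependence of the inner integral on u: the noise has the same law
   for every value of U. *)
have E (w : TT) : (\int[leb]_y ((gaussian_density (mu + row_of_tuple w.1) Lam y)%:E *
    (\1_A (V (w.1, y)))%:E) = \int[leb]_x (gaussian_density mu Lam x * \1_A x)%:E)%E.
  transitivity (\int[leb]_y F (shift_tuple (- row_of_tuple w.1) y))%E; last first.
    exact: lebesgue_tuple_translation.
  apply: eq_integral => y _; rewrite -EFinM /F; congr (_ * _)%:E.
  by rewrite !gaussian_densityE row_of_shift_tuple opprD addrA [_ - mu - _]addrAC.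
under eq_integral do rewrite E.
have [c cE] : exists c : R, (\int[leb]_x (gaussian_density mu Lam x * \1_A x)%:E = c%:E)%E.
  exists (fine (\int[leb]_x (gaussian_density mu Lam x * \1_A x)%:E)).
  rewrite fineK// ge0_fin_numE; last by apply: integral_ge0 => x _; rewrite lee_fin.
  apply: (@le_lt_trans _ _ (\int[leb]_x (gaussian_density mu Lam x)%:E)%E).
    apply: ge0_le_integral => //.
    - by move=> x _; rewrite lee_fin.
    - by apply/measurable_EFinP; exact: measurable_gaussian_density.
    - by move=> x _; rewrite lee_fin ler_piMr ?gaussian_density_ge0// indicE lern1 leq_b1.
  by rewrite integral_gaussian_density_diag// ltry.
rewrite cE integral_probability_cst -cE [RHS]integral_mkcond.
apply: eq_integral => x _; rewrite patchE indicE.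
by case: ifP => _; rewrite ?mulr1 ?mulr0.
Qed.

Let lawY A : measurable A -> (distribution Q (rvector Y) A =
  \int[leb]_(x in A) (gaussian_density mu Sigma x)%:E)%E.
Proof. by move=> mA; rewrite channel_output_law// lawX. Qed.

Let Z i (w : TT) := tnth w.2 i - mu 0 i.
Let ZE i (w : TT) : Z i w = tnth (rvector Y w) i - mu 0 i.
Proof. by rewrite rvectorY. Qed.

Let res i (w : TT) := tnth (V w) i - mu 0 i.

Let c0 (K : 'M[R]_n) : 0 <= (Num.sqrt ((2 * pi) ^+ n * \det K))^-1.
Proof. by rewrite invr_ge0 sqrtr_ge0. Qed.

Let mtnth i j : measurable_fun setT
  (fun t : n.-tuple R => (tnth t i - mu 0 i) * (tnth t j - mu 0 j)).
Proof.
by apply: measurable_funM; apply: measurable_funB => //; exact: measurable_tnth.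
Qed.

Let ZZi i j : Q.-integrable setT (EFin \o (fun w => Z i w * Z j w)).
Proof.
have := integrable_distribution (mtnth i j)
  (gaussian_integrable2 (Q := distribution Q (rvector Y)) sSigma (mulmxV uSigma) (c0 _) lawY i j).
by under eq_fun do rewrite -!ZE.
Qed.

Let ZZ i j : \int[Q]_w (Z i w * Z j w) = Sigma i j.
Proof.
rewrite -(gaussian_covariance (Q := distribution Q (rvector Y)) sSigma (mulmxV uSigma) (c0 _) lawY i j).
rewrite (Rintegral_distribution (mtnth i j)
  (gaussian_integrable2 (Q := distribution Q (rvector Y)) sSigma (mulmxV uSigma) (c0 _) lawY i j)).
by apply: eq_Rintegral => w _; rewrite !ZE.
Qed.

Let resi i j : Q.-integrable setT (EFin \o (fun w => res i w * res j w)).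
Proof.
exact: (integrable_distribution (mtnth i j)
  (gaussian_integrable2 (Q := distribution Q V) sLam (mulmxV uLam) (c0 _) lawV i j)).
Qed.

Let res2 i j : \int[Q]_w (res i w * res j w) = Lam i j.
Proof.
rewrite -(gaussian_covariance (Q := distribution Q V) sLam (mulmxV uLam) (c0 _) lawV i j).
by rewrite (Rintegral_distribution (mtnth i j)
  (gaussian_integrable2 (Q := distribution Q V) sLam (mulmxV uLam) (c0 _) lawV i j)).
Qed.

Let trace_inv (K : 'M[R]_n) : K \in unitmx -> K^T = K ->
  \sum_i \sum_j invmx K i j * K i j = n%:R.
Proof.
move=> uK sK; transitivity (\tr (invmx K *m K)); last by rewrite mulVmx// mxtrace1.
apply: eq_bigr => i _; rewrite mxE; apply: eq_bigr => j _.
by congr (_ * _); rewrite -[in LHS]sK mxE.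
Qed.

(** The joint law has density e^f with respect to the product law. Both quadratic forms have
    expectation n, so they cancel and only the log-determinant constant remains. *)
Lemma channel_mutual_information b :
  mutual_information b U (rvector Y) = (2^-1 * logb b (\det Sigma / \det Lam))%:E.
Proof.
pose C := 2^-1 * ln (\det Sigma / \det Lam).
pose f (p : TT) : R :=
  C - bform (invmx Lam) (row_of_tuple p.2 - (mu + row_of_tuple p.1)) (row_of_tuple p.2 - (mu + row_of_tuple p.1)) / 2
  + bform (invmx Sigma) (row_of_tuple p.2 - mu) (row_of_tuple p.2 - mu) / 2.
have fE w : f w = C - bform (invmx Lam) (\row_i res i w) (\row_i res i w) / 2
    + bform (invmx Sigma) (\row_i Z i w) (\row_i Z i w) / 2.
  rewrite /f.
  have -> : row_of_tuple w.2 - (mu + row_of_tuple w.1) = \row_i res i w.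
    by apply/rowP => i; rewrite !mxE /res /V /= tnth_mktuple !mxE opprD addrA addrAC.
  have -> // : row_of_tuple w.2 - mu = \row_i Z i w.
  by apply/rowP => i; rewrite !mxE.
have i1 : Q.-integrable setT (EFin \o (fun w => bform (invmx Lam) (\row_i res i w) (\row_i res i w) / 2)).
  under eq_fun do rewrite mulrC; apply: integrable_scaleR.
  by apply: (integrable_bform (f := res)) => // w i; rewrite mxE.
have i2 : Q.-integrable setT (EFin \o (fun w => bform (invmx Sigma) (\row_i Z i w) (\row_i Z i w) / 2)).
  under eq_fun do rewrite mulrC; apply: integrable_scaleR.
  by apply: (integrable_bform (f := Z)) => // w i; rewrite mxE.
have i3 : Q.-integrable setT (EFin \o (fun w => C - bform (invmx Lam) (\row_i res i w) (\row_i res i w) / 2)).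
  by apply: integrable_subR => //; exact: integrable_cstR.
have fi : Q.-integrable setT (EFin \o f).
  by have := integrable_addR i3 i2; apply: eq_integrable => // w _ /=; rewrite fE.
have mf : measurable_fun setT f by apply/measurable_EFinP; exact: measurable_int fi.
have Ef : \int[Q]_w f w = C.
  under eq_Rintegral do rewrite fE.
  rewrite RintegralD// RintegralB//; last exact: integrable_cstR.
  rewrite Rintegral_probability_cst.
  rewrite RintegralZr//; last by apply: (integrable_bform (f := res)) => // w i; rewrite mxE.
  rewrite RintegralZr//; last by apply: (integrable_bform (f := Z)) => // w i; rewrite mxE.
  rewrite (Rintegral_bform (f := res))//; last by move=> w i; rewrite mxE.
  rewrite (Rintegral_bform (f := Z))//; last by move=> w i; rewrite mxE.
  under eq_bigr do under eq_bigr do rewrite res2.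
  under [X in _ + X / _]eq_bigr do under eq_bigr do rewrite ZZ.
  by rewrite !trace_inv// subrK.
pose W := rpair U (rvector Y).
(* U and Y are the two projections, so their joint law is [Q] itself. *)
have WE w : W w = w.
  transitivity (w.1, rvector Y w) => //.
  by rewrite rvectorY -surjective_pairing.
have lawW A : measurable A -> distribution Q W A = Q A.
  move=> mA; rewrite -[LHS]/(Q (W @^-1` A)); congr (Q _).
  by apply/seteqP; split=> w /=; rewrite WE.
have mr : measurable_fun setT (fun w => expR (f w)) by exact: measurableT_comp.
have r0 w : 0 <= expR (f w) by exact: expR_ge0.
rewrite /mutual_information (kl_divergence_density b mr r0); last first.
  move=> A mA; transitivity (Q A); first exact: lawW.
  rewrite [RHS]integral_mkcond.
  have mrA : measurable_fun setT ((fun w => (expR (f w))%:E) \_ A).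
    by apply/(measurable_restrictT _ _).1 => //; apply/measurable_funTS/measurable_EFinP.
  have rA0 w : (0 <= ((fun w => (expR (f w))%:E) \_ A) w)%E.
    by rewrite patchE; case: ifP => //; rewrite lee_fin.
  rewrite (fubini_tonelli1 _ mrA rA0).
  have mF := measurable_fun_fubini_tonelli_F (m2 := distribution Q (rvector Y)) _ mrA rA0.
  rewrite ge0_integral_distribution//; last by move=> u; exact: integral_ge0.
  rewrite (intI Q mA) (intcond (phi := fun w => (\1_A w)%:E)); last 2 first.
  - by apply/measurable_EFinP; exact: measurable_indic.
  - by move=> w; rewrite lee_fin.
  apply: eq_integral => w _; rewrite /= /fubini_F.
  rewrite (@ge0_integral_density _ _ _ (distribution Q (rvector Y)) leb _
    (measurable_gaussian_density mu Sigma) (gaussian_density_ge0 mu Sigma) lawY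
    (fun y => ((fun w => (expR (f w))%:E) \_ A) (w.1, y))); last 2 first.
  - exact: (measurableT_comp mrA (measurable_pair1 w.1)).
  - by move=> y; exact: rA0.
  apply: eq_integral => y _; rewrite patchE indicE.
  case: ifP => _; rewrite ?mule0// mule1 -EFinM.
  by rewrite (gaussian_density_ratio _ mu y detLam detSigma).
rewrite (@eq_measure_integral _ _ _ setT Q); last by move=> A mA _; exact: lawW.
under eq_integral do rewrite /logb expRK EFinM.
rewrite integralZr// -[X in (X * _)%E]fineK; last exact: integrable_fin_num.
by rewrite -EFinM -/(Rintegral Q setT f) Ef /logb /C mulrA.
Qed.

End achievability.

(** * Mean and covariance of a Gaussian law *)

Section gaussian_law.
Context {R : realType} {m : nat} {d : measure_display} {Omega : measurableType d}
  (P : probability Omega R) (X : 'I_m -> {RV P >-> R}).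
Variables (mu : 'rV[R]_m) (K : 'M[R]_m).
Hypothesis lawX : forall A, measurable A -> (distribution P (rvector X) A =
  \int[lebesgue_tuple m]_(x in A) (gaussian_density mu K x)%:E)%E.

(** For a nonpositive determinant the square root is 0, and so is its inverse by convention; the
    density would vanish identically, against total mass 1. *)
Lemma gaussian_law_det_gt0 : 0 < \det K.
Proof.
rewrite ltNge; apply/negP => K0.
have := lawX measurableT.
under eq_integral => x _.
  rewrite /gaussian_density ler0_sqrtr ?invr0 ?mul0r; last first.
    by rewrite mulr_ge0_le0// ltW// twopiX_gt0.
  over.
rewrite integral0; have -> : distribution P (rvector X) setT = 1%E by exact: probability_setT.
by move/eqP; rewrite onee_eq0.
Qed.

Hypothesis pK : posdefmx K.

Let uK := posdefmx_unit pK.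
Let sK : K^T = K. Proof. by case: pK. Qed.

Let c0 : 0 <= (Num.sqrt ((2 * pi) ^+ m * \det K))^-1.
Proof. by rewrite invr_ge0 sqrtr_ge0. Qed.

Let Z i w := X i w - mu 0 i.

Let ZE i w : Z i w = tnth (rvector X w) i - mu 0 i.
Proof. by rewrite tnth_mktuple. Qed.

Let mt i : measurable_fun setT (fun t : m.-tuple R => tnth t i - mu 0 i).
Proof. by apply: measurable_funB => //; exact: measurable_tnth. Qed.

Let mtt i j : measurable_fun setT
  (fun t : m.-tuple R => (tnth t i - mu 0 i) * (tnth t j - mu 0 j)).
Proof. exact: measurable_funM. Qed.

Let Q := distribution P (rvector X).
Let i1 i := gaussian_integrable (Q := Q) sK (mulmxV uK) c0 lawX i.
Let i2 i j := gaussian_integrable2 (Q := Q) sK (mulmxV uK) c0 lawX i j.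

Lemma gaussian_law_expectation i : ('E_P[X i] = (mu 0 i)%:E)%E.
Proof.
have iZ : P.-integrable setT (EFin \o Z i).
  have := integrable_distribution (mt i) (i1 i).
  by under eq_fun do rewrite -!ZE.
have EZ : \int[P]_w Z i w = 0.
  rewrite -(gaussian_mean (Q := Q) sK (mulmxV uK) c0 lawX i).
  rewrite (Rintegral_distribution (mt i) (i1 i)).
  by apply: eq_Rintegral => w _; rewrite !ZE.
rewrite unlock; transitivity (\int[P]_w (Z i w + mu 0 i)%:E)%E.
  by apply: eq_integral => w _; rewrite subrK.
rewrite -[LHS]fineK; last first.
  apply: integrable_fin_num => //.
  exact: (integrable_addR iZ (integrable_cstR _ _)).
rewrite -/(Rintegral P setT (fun w => Z i w + mu 0 i)).
rewrite RintegralD//; last exact: integrable_cstR.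
by rewrite EZ Rintegral_probability_cst add0r.
Qed.

Lemma gaussian_law_covariance i j : (covariance P (X i) (X j) = (K i j)%:E)%E.
Proof.
have iZ : P.-integrable setT (EFin \o (fun w => Z i w * Z j w)).
  have := integrable_distribution (mtt i j) (i2 i j).
  by under eq_fun do rewrite -!ZE.
have EZ : \int[P]_w (Z i w * Z j w) = K i j.
  rewrite -(gaussian_covariance (Q := Q) sK (mulmxV uK) c0 lawX i j).
  rewrite (Rintegral_distribution (mtt i j) (i2 i j)).
  by apply: eq_Rintegral => w _; rewrite !ZE.
rewrite covariance.unlock !gaussian_law_expectation/= expectation.unlock.
by rewrite -EZ /Rintegral fineK//; exact: integrable_fin_num.
Qed.

End gaussian_law.

(** With t = s / (1 + s) the quantity (1 - t)^-1 - 1 is exactly s. Dividing by c + 1 instead of c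
    allows c = 0. *)
Lemma small_parameter {R : realType} (c e : R) : 0 <= c -> 0 < e ->
  exists t, [/\ 0 < t, t < 1 & c * ((1 - t)^-1 - 1) <= e].
Proof.
move=> c0 e0; pose s := e / (c + 1).
have s0 : 0 < s by rewrite divr_gt0// ltr_wpDl.
have s1 : 0 < 1 + s by rewrite addr_gt0.
exists (s / (1 + s)); split; first exact: divr_gt0.
  by rewrite ltr_pdivrMr// mul1r ltrDr.
have -> : 1 - s / (1 + s) = (1 + s)^-1 by field; rewrite gt_eqF.
rewrite invrK [1 + s]addrC addrK /s mulrCA ler_piMr ?(ltW e0)//.
by rewrite ler_pdivrMr ?mul1r ?lerDl// ltr_wpDl.
Qed.

(** * The two inequalities between common information and infimum *)

Section common_information.
Context {R : realType} (b : R) {m : nat} {d : measure_display}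
  {Omega : measurableType d} (P : probability Omega R) (X : 'I_m -> {RV P >-> R}).
Variables (mu : 'rV[R]_m) (Sigma : 'M[R]_m).
Hypotheses (b1 : 1 < b) (pSigma : posdefmx Sigma).
Hypothesis lawX : forall A, measurable A -> (distribution P (rvector X) A =
  \int[lebesgue_tuple m]_(x in A) (gaussian_density mu Sigma x)%:E)%E.

Let detSigma : 0 < \det Sigma. Proof. exact: gaussian_law_det_gt0 lawX. Qed.
Let lnb : 0 < ln b. Proof. by rewrite ln_gt0. Qed.

Definition feasible (Lam : 'M[R]_m) : Prop :=
  [/\ is_diag_mx Lam, forall i, 0 < Lam i i & loewner_le Lam Sigma].

Lemma wyner_le (Lam : 'M[R]_m) : feasible Lam ->
  (wyner_common_information b X <= (2^-1 * logb b (\det Sigma / \det Lam))%:E)%E.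
Proof.
move=> [dLam Lam0 [sLam pLam]]; apply/lee_addgt0Pr => e e0.
have [t [t0 t1 te]] : exists t, [/\ 0 < t, t < 1 &
    m%:R / (2 * ln b) * ((1 - t)^-1 - 1) <= e].
  by apply: small_parameter => //; rewrite divr_ge0// mulr_ge0// ltW.
have t1' : 0 < 1 - t by rewrite subr_gt0.
pose L := (1 - t) *: Lam.
have L0 i : 0 < L i i by rewrite mxE mulr_gt0.
have dL : is_diag_mx L.
  by apply/is_diag_mxP => i j ij; rewrite mxE (is_diag_mxP dLam)// mulr0.
have detL : \det L = (1 - t) ^+ m * \det Lam by rewrite detZ.
(* Sigma - Lam is only semidefinite; the added t Lam makes the difference definite, as all diagonal
   entries of Lam are positive. *)
have pG : posdefmx (Sigma - L).
  have E : Sigma - L = (Sigma - Lam) + t *: Lam.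
    by rewrite /L scalerBl scale1r opprB addrA addrAC.
  split=> [|u u0].
    rewrite E linearD linearZ /= sLam; congr (_ + _ *: _).
    by rewrite (diag_mx_coef dLam) tr_diag_mx.
  rewrite -/(bform _ u u) E bformDmx bformZmx ltr_wpDl//; first exact: pLam.
  rewrite mulr_gt0// bform_diag//.
  have [i ui] : exists i, u 0 i != 0.
    apply/existsP; apply: contraNT u0 => /existsPn H.
    by apply/eqP/rowP => i; rewrite mxE; apply/eqP; have := H i; rewrite negbK.
  rewrite (bigD1 i)//= ltr_pwDl//.
    by rewrite mulr_gt0// exprn_even_gt0.
  by apply: sumr_ge0 => j _; rewrite mulr_ge0 ?sqr_ge0// ltW.
have [Q [intY intcond]] := gaussian_backward_channel pSigma dL L0 pG lawX.
have le : (wyner_common_information b X <= (2^-1 * logb b (\det Sigma / \det L))%:E)%E.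
  rewrite -(channel_mutual_information pSigma detSigma dL L0 lawX intY intcond b).
  apply: ereal_inf_lbound; do 5 eexists.
  exists (channel_output Q), (channel_input Q); split=> //.
  - by move=> A mA; exact: channel_output_law intY A mA.
  - exact: channel_cond_independent intcond.
apply: (le_trans le); rewrite -EFinD lee_fin.
have detLam := det_diag_gt0 dLam Lam0.
(* Shrinking Lam by 1 - t scales its determinant by (1 - t)^m; the cost is then controlled by ln y
   <= y - 1 at y = (1 - t)^-1. *)
have -> : logb b (\det Sigma / \det L) =
    logb b (\det Sigma / \det Lam) + m%:R * (ln (1 - t)^-1 / ln b).
  rewrite /logb detL invfM mulrCA lnM ?posrE ?divr_gt0 ?invr_gt0 ?exprn_gt0//.
  by rewrite -exprVn lnXn ?invr_gt0// -mulr_natl; ring.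
rewrite mulrDr lerD2l; apply: le_trans te.
have ln_le (y : R) : 0 < y -> ln y <= y - 1.
  by move=> y0; have := @le_ln1Dx _ (y - 1); rewrite [1 + _]addrC subrK; apply; lra.
have -> : 2^-1 * (m%:R * (ln (1 - t)^-1 / ln b)) = m%:R / (2 * ln b) * ln (1 - t)^-1.
  by rewrite invfM; ring.
apply: ler_wpM2l; first by rewrite divr_ge0// mulr_ge0// ltW.
by apply: ln_le; rewrite invr_gt0.
Qed.

(** Phrased for an arbitrary lower bound [x] of the feasible values, later taken to be half the
    infimum, so that each coupling is compared with a single feasible matrix. *)
Lemma wyner_ge (x : \bar R) :
  (forall Lam, feasible Lam -> x <= (2^-1 * logb b (\det Sigma / \det Lam))%:E)%E ->
  (x <= wyner_common_information b X)%E.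
Proof.
move=> H; apply: le_ereal_inf_tmp => I /=.
case=> d1; case=> d2; case=> Omega1; case=> T; case=> P1; case=> Y; case=> U [lawY ciY IE].
rewrite {}IE.
have lawY' A : measurable A -> (distribution P1 (rvector Y) A =
    \int[lebesgue_tuple m]_(x in A) (gaussian_density mu Sigma x)%:E)%E.
  by move=> mA; rewrite lawY// lawX.
apply/lee_addgt0Pr => e e0.
have [t [t0 t1 te]] : exists t, [/\ 0 < t, t < 1 &
    m%:R / 2 / ln b * ((1 - t)^-1 - 1) <= e].
  by apply: small_parameter => //; rewrite !divr_ge0// ltW.
have [D [dD D0 DS le]] := mutual_information_ge pSigma detSigma lawY' ciY b1 t0 t1.
apply: (le_trans (H D _)) => //.
rewrite -leeBlDr//; apply: le_trans le.
by rewrite -EFinB lee_fin lerD2l lerN2 mulrAC.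
Qed.

End common_information.

Theorem mainTheorem7 (R : realType) (b : R) (m : nat) (d : measure_display)
    (Omega : measurableType d) (P : probability Omega R)
    (X : 'I_m -> {RV P >-> R}) (Sigma : 'M[R]_m)
    (hb : 1 < b)
    (hX : jointly_gaussian X)
    (hcov : forall i j : 'I_m, covariance P (X i) (X j) = (Sigma i j)%:E)
    (hSigma : posdefmx Sigma) :
  wyner_common_information b X =
  ((2^-1)%:E *
   ereal_inf [set (logb b (\det Sigma / \det Lambda))%:E
             | Lambda in [set Lambda : 'M[R]_m |
                 [/\ is_diag_mx Lambda,
                     forall i, (0 < Lambda i i)%R &
                     loewner_le Lambda Sigma]]])%E.
Proof.
have [mu [K [pK lawX]]] := hX.
(* [jointly_gaussian] provides some parameter [K]; computing the covariances of the law identifies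
   it with [Sigma]. *)
have KS : K = Sigma.
  apply/matrixP => i j; apply: EFin_inj.
  by rewrite -hcov (gaussian_law_covariance lawX pK).
rewrite {}KS in pK lawX.
apply/eqP; rewrite eq_le; apply/andP; split.
- rewrite lee_pdivlMl//.
  apply: le_ereal_inf_tmp => _ [Lam fLam <-].
  by rewrite -lee_pdivlMl// -EFinM; exact: (wyner_le hb hSigma lawX).
- apply: (wyner_ge hb hSigma lawX) => Lam fLam.
  rewrite EFinM lee_pmul2l ?lte_fin ?invr_gt0//.
  by apply: ereal_inf_lbound; exists Lam.
Qed.
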